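(* Let $(R,\mathfrak m)$ be a $d$-dimensional Gorenstein local ring and let $I=J\colon\mathfrak m$, where $J=(z_1,\ldots,z_d)$ is generated by a regular sequence $z_1,\ldots,z_d$ of $R$ of length $d$. Let $\mathfrak M=(\mathfrak m, It)$ be the maximal homogeneous ideal of $R[It]$ and let $\mathfrak N=(\mathfrak m,Jt)$ be the maximal homogeneous ideal of $R[Jt]$. Suppose that either of the following two conditions holds: (L$_1$) $R$ is not a regular local ring; (L$_2$) $R$ is a regular local ring of dimension at least $2$ and two elements in the sequence $z_1,\ldots,z_d$ lie in the symbolic square $\mathfrak m^{(2)}=\mathfrak m^{2}$. Then the multiplicities of the two Rees algebras with respect to their maximal homogeneous ideals are equal: $$e(\mathfrak M,R[It])=e(\mathfrak N,R[Jt]).$$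
   Context: All rings are Noetherian. For an ideal $I$ of $R$, the Rees algebra is $R[It]=\bigoplus_{i\ge0}I^it^i\subset R[t]$. For the maximal homogeneous ideal $\mathfrak M$ of such an algebra $B$, $e(\mathfrak M,B)$ denotes the Hilbert--Samuel multiplicity of $B$ with respect to $\mathfrak M$.
   Formalization: The dimension d is assumed positive: for d = 0 the claim fails under (L1), e.g. R = k[x]/(x^2), J = 0, I = (x), where e(R[It]) = 3 but e(R[Jt]) = 2. *)

(* Defs.v *)
From HB Require Import structures.
From mathcomp Require Import all_boot all_order all_algebra.
From mathcomp Require Import boolp classical_sets.

Set Implicit Arguments.
Unset Strict Implicit.
Unset Printing Implicit Defensive.
Import Order.TTheory GRing.Theory Num.Theory.
Local Open Scope classical_set_scope.
Local Open Scope ring_scope.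

(* Unlike the ideals of ring_quotient, these need be neither decidable nor
   proper: the unit ideal is needed as the zeroth power of an ideal. *)
Definition is_ideal (R : comNzRingType) (A : set R) : Prop :=
  [/\ A 0, forall x y, A x -> A y -> A (x + y) & forall r x, A x -> A (r * x)].

Definition ideal_gen (R : comNzRingType) (S : set R) : set R :=
  smallest (@is_ideal R) S.

Definition ideal_mul (R : comNzRingType) (A B : set R) : set R :=
  ideal_gen [set x * y | x in A & y in B].

Definition ideal_exp (R : comNzRingType) (A : set R) (n : nat) : set R :=
  iter n (ideal_mul A) setT.

Definition colon (R : comNzRingType) (A B : set R) : set R :=
  [set x | forall y, B y -> A (x * y)].

Definition prime_ideal (R : comNzRingType) (P : set R) : Prop :=
  [/\ is_ideal P, ~ P 1 & forall x y, P (x * y) -> P x \/ P y].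

Definition maximal_ideal (R : comNzRingType) (m : set R) : Prop :=
  [/\ is_ideal m, ~ m 1 &
      forall A, is_ideal A -> ~ A 1 -> m `<=` A -> A = m].

Definition noetherian (R : comNzRingType) : Prop :=
  forall A : set R, is_ideal A -> exists s : seq R, A = ideal_gen [set` s].

Definition local_ring (R : comNzRingType) (m : set R) : Prop :=
  maximal_ideal m /\ forall n : set R, maximal_ideal n -> n = m.

Definition has_chain (T : Type) (C : set (set T)) (l : nat) : Prop :=
  exists c : nat -> set T,
    (forall i, (i <= l)%N -> C (c i)) /\
    (forall i, (i < l)%N -> c i `<` c i.+1).

(* A chain of length l.+2 or more truncates to one of length l.+1. *)
Definition max_chain_length (T : Type) (C : set (set T)) (l : nat) : Prop :=
  has_chain C l /\ ~ has_chain C l.+1.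

Definition krull_dim (R : comNzRingType) (d : nat) : Prop :=
  max_chain_length [set P : set R | prime_ideal P] d.

(* The length of the R-module R / A is l: its submodules are the ideals of R
   that contain A. *)
Definition colength (R : comNzRingType) (A : set R) (l : nat) : Prop :=
  max_chain_length [set B : set R | is_ideal B /\ A `<=` B] l.

Definition regular_local_ring (R : comNzRingType) (m : set R) : Prop :=
  [/\ noetherian R, local_ring m &
      exists2 d, krull_dim R d &
        exists x : d.-tuple R, m = ideal_gen [set` x]].

Definition regular_sequence (R : comNzRingType) (s : seq R) : Prop :=
  ~ ideal_gen [set` s] 1 /\
  forall i x, (i < size s)%N ->
    ideal_gen [set` take i s] (s`_i * x) -> ideal_gen [set` take i s] x.

Definition injective_module (R : comNzRingType) (E : lmodType R) : Prop :=
  forall (M N : lmodType R) (f : {linear M -> N}) (g : {linear M -> E}),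
    injective f -> exists h : {linear N -> E}, forall x, h (f x) = g x.

(* A finite injective resolution 0 -> M -> E 0 -> ... -> E n -> 0. *)
Definition finite_injective_dim (R : comNzRingType) (M : lmodType R) : Prop :=
  exists (n : nat) (E : nat -> lmodType R) (aug : {linear M -> E 0%N})
         (del : forall i, {linear E i -> E i.+1}),
    [/\ forall i, injective_module (E i),
        injective aug,
        range aug = [set y | del 0%N y = 0],
        forall i, range (del i) = [set y | del i.+1 y = 0] &
        forall i, (n < i)%N -> forall y : E i, y = 0].

Definition gorenstein_local_ring (R : comNzRingType) (m : set R) : Prop :=
  [/\ noetherian R, local_ring m & finite_injective_dim R^o].

Definition rees_pred (R : comNzRingType) (I : set R) (p : {poly R}) : bool :=
  `[< forall i, ideal_exp I i p`_i >].

Lemma ideal_gen_ideal (R : comNzRingType) (S : set R) : is_ideal (ideal_gen S).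
Proof.
split=> [A [[]//]|x y Sx Sy A AP|r x Sx A AP]; case: (AP) => -[_ AD AM] _.
- by apply: AD; [exact: Sx | exact: Sy].
- by apply: AM; exact: Sx.
Qed.

Lemma ideal_exp_ideal (R : comNzRingType) (A : set R) n :
  is_ideal (ideal_exp A n).
Proof. by case: n => [|n]; [split | exact: ideal_gen_ideal]. Qed.

Lemma ideal_expD (R : comNzRingType) (A : set R) i j x y :
  ideal_exp A i x -> ideal_exp A j y -> ideal_exp A (i + j) (x * y).
Proof.
move=> Aix Ajy; elim: i x Aix => [|i IHi] x Aix.
  by have [_ _] := ideal_exp_ideal A j; exact.
apply: (Aix [set x | ideal_exp A (i.+1 + j) (x * y)]); split=> [|_ [a Aa [b Ab <-]]].
  have [A0 AD AM] := ideal_exp_ideal A (i.+1 + j).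
  split=> [|u v Au Av|r u Au] /=.
  - by rewrite mul0r.
  - by rewrite mulrDl; exact: AD.
  - by rewrite -mulrA; exact: AM.
rewrite /= -mulrA; apply: sub_smallest (@subset_refl _ _) _ _.
by exists a => //; exists (b * y) => //; exact: IHi.
Qed.

Lemma rees_subring (R : comNzRingType) (I : set R) :
  subring_closed (rees_pred I : {pred {poly R}}).
Proof.
split=> [|p q /asboolP Ip /asboolP Iq|p q /asboolP Ip /asboolP Iq];
  apply/asboolP=> i; have [I0 ID IM] := ideal_exp_ideal I i.
- by rewrite coef1; case: i I0 {ID IM}.
- by rewrite coefB -mulN1r; apply: (ID) => //; exact: (IM).
- rewrite coefM; elim/big_ind: _ => // j _.
  by rewrite -[X in ideal_exp I X](subnKC (leq_ord j)); exact: ideal_expD.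
Qed.

HB.instance Definition _ (R : comNzRingType) (I : set R) :=
  GRing.isSubringClosed.Build {poly R} (rees_pred I) (@rees_subring R I).

(* The Rees algebra R[It], as a subring of R[t] = {poly R}. *)
Definition rees (R : comNzRingType) (I : set R) : Type :=
  {p : {poly R} | rees_pred I p}.

HB.instance Definition _ (R : comNzRingType) (I : set R) :=
  SubType.on (rees I).
HB.instance Definition _ (R : comNzRingType) (I : set R) :=
  [Choice of rees I by <:].
HB.instance Definition _ (R : comNzRingType) (I : set R) :=
  [SubChoice_isSubComNzRing of rees I by <:].

(* The ideal (m, It) of R[It]. *)
Definition rees_max (R : comNzRingType) (m I : set R) : set (rees I) :=
  ideal_gen ([set p : rees I | exists2 c, m c & val p = c%:P] `|`
             [set p : rees I | exists2 a, I a & val p = a *: 'X]).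
Arguments rees_max {R} m I _.

Definition hilbert_samuel_poly (B : comNzRingType) (M : set B) (P : {poly rat})
    : Prop :=
  exists n0 : nat, forall n, (n0 <= n)%N ->
    exists2 l : nat, colength (ideal_exp M n) l & P.[n%:R] = l%:R.

(* e(M, B) = D! * (leading coefficient of the Hilbert-Samuel polynomial), where
   D is the degree of that polynomial (equivalently, the dimension of B
   localized at M).  By the Hilbert-Samuel theorem the polynomial exists, and is
   then unique, as soon as B is Noetherian and M is a maximal ideal; the default
   value 0 is taken only outside that situation. *)
Definition multiplicity (B : comNzRingType) (M : set B) : rat :=
  xget 0 [set e | exists2 P, hilbert_samuel_poly M P &
                             e = ((size P).-1)`!%:R * lead_coef P].

(* Main.v *)
Require Import Defs.
From mathcomp Require Import all_boot all_order all_algebra.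
From mathcomp Require Import boolp classical_sets.
From mathcomp Require Import ring zify.

(* Put J = (z_1, ..., z_d) and I = J : m.  If mI <> mJ then some xw, with x in m
   and w in I, is a minimal generator of J, and m is generated by x and the
   remaining d - 1 elements z_i; then R is regular, and at most one z_i can lie
   in m^2.  Hence mI = mJ.  As z_1, ..., z_d is quasi-regular, it follows that
   I^2 = IJ.

   The ideals (m, It)^n and (m, Jt)^n have the components m^(n-i) I^i and
   m^(n-i) J^i, which coincide for 0 < i < n.  The two colengths therefore differ
   by the sum over 0 < i < n of the lengths of I^i/J^i = I J^(i-1)/J^i, that is,
   by a polynomial in n of degree at most d, whereas the Hilbert-Samuel
   polynomials have degree at least d + 1.  So one of these polynomials exists if
   and only if the other does, and then their leading terms agree; the
   Hilbert-Samuel theorem is not needed. *)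

Set Implicit Arguments.
Unset Strict Implicit.
Unset Printing Implicit Defensive.
Import Order.TTheory GRing.Theory Num.Theory.
Local Open Scope classical_set_scope.
Local Open Scope ring_scope.

(** * Ideals *)

(** The common tool is quasi-regularity: if a combination of the degree-n monomials in z_1, ..., z_d
    lies in J^(n+1), then its coefficients lie in J. In degree 1 it yields both the exclusion of
    minimal generators xw and the equality I^2 = IJ; in all degrees it makes K J^n/J^(n+1) a direct
    sum of copies of K/J, for K = R and K = I, which gives every exact length.

    A length is the maximal length of a chain of ideals and hence only a relation: each finite
    length has to be established before it can be added. Additivity then allows the colength of a
    power of (m, It) to be computed one degree in t at a time.

    The bound d + 1 on the degree comes from some m^c contained in J. It exists because m is the
    only prime over J: d regular elements already account for a chain of primes of length d below
    any such prime. For n = (c+2)k and k <= i < 2k one gets m^(n-i) J^i inside J^(i+k); each of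
    these k degrees then contributes at least a constant times k^d. *)

Section Ideals.
Variable R : comNzRingType.
Implicit Types (A B C : set R) (s : seq R) (x y r : R).

Lemma ideal0 A : is_ideal A -> A 0. Proof. by case. Qed.

Lemma idealD A x y : is_ideal A -> A x -> A y -> A (x + y).
Proof. by case=> _ AD _; exact: AD. Qed.

Lemma idealMl A r x : is_ideal A -> A x -> A (r * x).
Proof. by case=> _ _ AM; exact: AM. Qed.

Arguments idealMl {A r x}.

Lemma idealMr A r x : is_ideal A -> A x -> A (x * r).
Proof. by move=> iA Ax; rewrite mulrC; exact: idealMl. Qed.

Arguments idealMr {A r x}.

Lemma idealN A x : is_ideal A -> A x -> A (- x).
Proof. by move=> iA Ax; rewrite -mulN1r; exact: idealMl. Qed.

Lemma idealB A x y : is_ideal A -> A x -> A y -> A (x - y).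
Proof. by move=> iA Ax Ay; apply: idealD => //; exact: idealN. Qed.

Lemma ideal1 A : is_ideal A -> A 1 -> A = setT.
Proof.
by move=> iA A1; apply/seteqP; split=> // x _; rewrite -[x]mulr1; exact: idealMl.
Qed.

Lemma is_idealT : is_ideal (setT : set R). Proof. by split. Qed.

Lemma is_idealI A B : is_ideal A -> is_ideal B -> is_ideal (A `&` B).
Proof.
move=> iA iB; split=> [|x y [Ax Bx] [Ay By]|r x [Ax Bx]].
- by split; exact: ideal0.
- by split; exact: idealD.
- by split; exact: idealMl.
Qed.

Definition addI A B : set R := [set a + b | a in A & b in B].

Lemma is_ideal_addI A B : is_ideal A -> is_ideal B -> is_ideal (addI A B).
Proof.
move=> iA iB; split.
- by exists 0; [exact: ideal0 | exists 0; [exact: ideal0 | rewrite addr0]].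
- move=> _ _ [a Aa [b Bb <-]] [a' Aa' [b' Bb' <-]].
  exists (a + a'); first exact: idealD.
  by exists (b + b'); [exact: idealD | ring].
- move=> r _ [a Aa [b Bb <-]].
  exists (r * a); first exact: idealMl.
  by exists (r * b); [exact: idealMl | ring].
Qed.

Lemma sub_addIl A B : is_ideal B -> A `<=` addI A B.
Proof. by move=> iB a Aa; exists a => //; exists 0; [exact: ideal0|rewrite addr0]. Qed.

Lemma sub_addIr A B : is_ideal A -> B `<=` addI A B.
Proof. by move=> iA b Bb; exists 0; [exact: ideal0|exists b => //; rewrite add0r]. Qed.

Lemma addI_min A B C : is_ideal C -> A `<=` C -> B `<=` C -> addI A B `<=` C.
Proof. by move=> iC AC BC _ [a /AC Ca [b /BC Cb <-]]; exact: idealD. Qed.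

Lemma sub_ideal_gen (S : set R) : S `<=` ideal_gen S.
Proof. exact: sub_gen_smallest. Qed.

Lemma ideal_gen_min (S A : set R) : is_ideal A -> S `<=` A -> ideal_gen S `<=` A.
Proof. exact: smallest_sub. Qed.

Definition gen s : set R := ideal_gen [set` s].

Lemma is_ideal_gen s : is_ideal (gen s).
Proof. exact: ideal_gen_ideal. Qed.
Hint Resolve is_ideal_gen : core.

Lemma mem_gen s x : x \in s -> gen s x.
Proof. exact: (@sub_ideal_gen [set` s]). Qed.

Lemma gen_min s A : is_ideal A -> (forall x, x \in s -> A x) -> gen s `<=` A.
Proof. by move=> iA sA; apply: ideal_gen_min. Qed.

Lemma eq_gen s t : s =i t -> gen s = gen t.
Proof.
by move=> st; congr ideal_gen; apply/seteqP; split=> x /=; rewrite st.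
Qed.

Lemma gen_sub s t : {subset s <= t} -> gen s `<=` gen t.
Proof. by move=> st; apply: gen_min => // x /st xt; exact: mem_gen. Qed.

Lemma gen_nil x : gen [::] x -> x = 0.
Proof.
apply: (@gen_min [::] [set 0]) => //.
by split=> [//|_ _ -> ->|r _ ->] /=; rewrite ?addr0 ?mulr0.
Qed.

Lemma gen_cons x s y : gen (x :: s) y <-> exists r, gen s (y - r * x).
Proof.
split=> [|[r gr]]; last first.
  rewrite -(subrK (r * x) y); apply: (idealD (is_ideal_gen _)).
    by apply: gen_sub gr => u us; rewrite inE us orbT.
  by apply: (idealMl (is_ideal_gen _)); apply: mem_gen; rewrite inE eqxx.
apply: (@gen_min _ [set y | exists r, gen s (y - r * x)]).
  split.
  - by exists 0; rewrite mul0r subr0; exact: (ideal0 (is_ideal_gen _)).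
  - move=> u v [a ga] [b gb]; exists (a + b).
    by rewrite (_ : _ - _ = (u - a * x) + (v - b * x)); [exact: (idealD (is_ideal_gen _)) | ring].
  - move=> r u [a ga]; exists (r * a).
    by rewrite (_ : _ - _ = r * (u - a * x)); [exact: (idealMl (is_ideal_gen _)) | ring].
move=> u; rewrite inE => /orP[/eqP->|us].
  by exists 1; rewrite mul1r subrr; exact: (ideal0 (is_ideal_gen _)).
by exists 0; rewrite mul0r subr0; exact: mem_gen.
Qed.

Lemma gen_cat s t : gen (s ++ t) = addI (gen s) (gen t).
Proof.
apply/seteqP; split.
  apply: gen_min; first exact: is_ideal_addI.
  move=> x; rewrite mem_cat => /orP[] xs.
    by apply: sub_addIl => //; exact: mem_gen.
  by apply: sub_addIr => //; exact: mem_gen.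
by apply: addI_min => //; apply: gen_sub => x; rewrite mem_cat => ->; rewrite ?orbT.
Qed.

Lemma is_ideal_mul A B : is_ideal (ideal_mul A B).
Proof. exact: ideal_gen_ideal. Qed.
Hint Resolve is_ideal_mul : core.

Lemma mem_mul A B x y : A x -> B y -> ideal_mul A B (x * y).
Proof. by move=> Ax By; apply: (@sub_ideal_gen [set u * v | u in A & v in B]); exists x => //; exists y. Qed.

Lemma mul_min A B C : is_ideal C -> (forall x y, A x -> B y -> C (x * y)) ->
  ideal_mul A B `<=` C.
Proof. by move=> iC ABC; apply: ideal_gen_min => // _ [x Ax [y By <-]]; exact: ABC. Qed.

Lemma mulS A B A' B' : A `<=` A' -> B `<=` B' -> ideal_mul A B `<=` ideal_mul A' B'.
Proof. by move=> AA BB; apply: mul_min => // x y /AA ? /BB ?; exact: mem_mul. Qed.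

Lemma mulSl A A' B : A `<=` A' -> ideal_mul A B `<=` ideal_mul A' B.
Proof. by move=> AA; exact: mulS. Qed.

Lemma mulSr A B B' : B `<=` B' -> ideal_mul A B `<=` ideal_mul A B'.
Proof. by move=> BB; exact: mulS. Qed.

Lemma mulIC A B : ideal_mul A B = ideal_mul B A.
Proof.
by apply/seteqP; split; apply: mul_min => // x y Ax By; rewrite mulrC; exact: mem_mul.
Qed.

Lemma is_ideal_colonl C y : is_ideal C -> is_ideal [set x | C (x * y)].
Proof.
move=> iC; split=> [|u v Cu Cv|r u Cu] /=.
- by rewrite mul0r; exact: ideal0.
- by rewrite mulrDl; exact: idealD.
- by rewrite -mulrA; exact: idealMl.
Qed.

Lemma is_ideal_scale A y : is_ideal A -> is_ideal [set a * y | a in A].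
Proof.
move=> iA; split.
- by exists 0; [exact: ideal0 | rewrite mul0r].
- move=> _ _ [a Aa <-] [b Ab <-]; exists (a + b); [exact: idealD | by rewrite mulrDl].
- by move=> r _ [a Aa <-]; exists (r * a); [exact: idealMl | rewrite mulrA].
Qed.

Lemma mulIA A B C : ideal_mul A (ideal_mul B C) = ideal_mul (ideal_mul A B) C.
Proof.
have sub A' B' C' : ideal_mul (ideal_mul A' B') C' `<=` ideal_mul A' (ideal_mul B' C').
  apply: mul_min => // x y ABx Cy.
  apply: (@mul_min A' B' [set x | ideal_mul A' (ideal_mul B' C') (x * y)]) ABx.
    exact: is_ideal_colonl.
  by move=> u v Au Bv /=; rewrite -mulrA; apply: mem_mul => //; exact: mem_mul.
apply/seteqP; split; last exact: sub.
by rewrite mulIC (mulIC B) (mulIC _ C) (mulIC A); exact: sub.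
Qed.

Lemma mulICA A B C : ideal_mul A (ideal_mul B C) = ideal_mul B (ideal_mul A C).
Proof. by rewrite mulIA (mulIC A) -mulIA. Qed.

Lemma mulTI A : is_ideal A -> ideal_mul setT A = A.
Proof.
move=> iA; apply/seteqP; split=> [|x Ax].
  by apply: mul_min => // x y _ Ay; exact: idealMl.
by rewrite -[x]mul1r; exact: mem_mul.
Qed.

Lemma mul_subr A B : is_ideal B -> ideal_mul A B `<=` B.
Proof. by move=> iB; apply: mul_min => // x y _ By; exact: idealMl. Qed.

Lemma mul_subl A B : is_ideal A -> ideal_mul A B `<=` A.
Proof. by rewrite mulIC; exact: mul_subr. Qed.

Lemma expS A n : ideal_exp A n.+1 = ideal_mul A (ideal_exp A n).
Proof. by []. Qed.

Lemma expD A a b :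
  ideal_exp A (a + b) = ideal_mul (ideal_exp A a) (ideal_exp A b).
Proof.
elim: a => [|a IH]; first by rewrite mulTI //; exact: ideal_exp_ideal.
by rewrite addSn !expS IH mulIA.
Qed.

Lemma exp1 A : is_ideal A -> ideal_exp A 1 = A.
Proof. by move=> iA; rewrite expS mulIC mulTI. Qed.

Lemma exp_sub A a b : (a <= b)%N -> ideal_exp A b `<=` ideal_exp A a.
Proof.
move=> /subnK <-; rewrite expD; apply: mul_subr; exact: ideal_exp_ideal.
Qed.

Lemma expSub A B n : A `<=` B -> ideal_exp A n `<=` ideal_exp B n.
Proof. by move=> AB; elim: n => // n IH; exact: mulS. Qed.

Lemma exp_exp A a b : ideal_exp A (a * b) = ideal_exp (ideal_exp A a) b.
Proof.
by elim: b => [|b IH]; rewrite ?muln0 // mulnS expD IH.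
Qed.

End Ideals.
#[local] Hint Resolve is_ideal_gen is_ideal_mul is_idealT ideal_exp_ideal : core.

Arguments idealMl {R A r x}.
Arguments idealMr {R A r x}.

(** * Lengths of intervals of ideals *)

Section Chains.
Variables (T U : Type).
Implicit Types (C : set (set T)) (l : nat).

(** Only nested pairs occur in a chain, so f need not be injective: it suffices that it reflects the
    reverse inclusion on nested pairs. Images and preimages of submodules satisfy this. *)
Lemma has_chain_map C (C' : set (set U)) (f : set T -> set U) l :
  (forall A, C A -> C' (f A)) ->
  (forall A B, C A -> C B -> A `<=` B -> f A `<=` f B) ->
  (forall A B, C A -> C B -> A `<=` B -> f B `<=` f A -> B `<=` A) ->
  has_chain C l -> has_chain C' l.
Proof.
move=> CC' fS fI [c [Cc cS]]; exists (f \o c); split=> [i il|i il] /=.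
  exact/CC'/Cc.
have [sub nsub] := cS i il; have Ci := Cc i (ltnW il); have CSi := Cc i.+1 il.
by split; [exact: fS | move=> /(fI _ _ Ci CSi sub)].
Qed.

Lemma has_chain_le C l l' : (l <= l')%N -> has_chain C l' -> has_chain C l.
Proof.
move=> ll' [c [Cc cS]]; exists c; split=> i il.
  by apply: Cc; exact: leq_trans ll'.
by apply: cS; exact: leq_trans ll'.
Qed.

Lemma max_chain_length_le C l l' :
  max_chain_length C l -> has_chain C l' -> (l' <= l)%N.
Proof.
by move=> [_ nC] C'; rewrite leqNgt; apply/negP => ll'; exact: nC (has_chain_le ll' C').
Qed.

Lemma max_chain_length_uniq C l l' :
  max_chain_length C l -> max_chain_length C l' -> l = l'.
Proof.
move=> Cl Cl'; apply/eqP; rewrite eqn_leq.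
by rewrite (max_chain_length_le Cl' Cl.1) (max_chain_length_le Cl Cl'.1).
Qed.

End Chains.

Section Length.
Variable R : comNzRingType.
Implicit Types (A B C D L K : set R) (l p q : nat).

Definition itv A B : set (set R) :=
  [set D | [/\ is_ideal D, A `<=` D & D `<=` B]].

(** The length of the module B/A. When that length is infinite, no l satisfies the relation. *)
Definition len A B l : Prop := max_chain_length (itv A B) l.

Lemma colengthE A l : colength A l = len A setT l.
Proof.
rewrite /colength /len; congr max_chain_length; apply/seteqP.
by split=> D; [case=> iD AD; split=> // x _ | case=> iD AD _; split].
Qed.

Lemma has_chain0 A B : is_ideal B -> A `<=` B -> has_chain (itv A B) 0.
Proof. by move=> iB AB; exists (fun=> B); split=> // i _; split. Qed.

Lemma has_chainW A B B' l : B `<=` B' -> has_chain (itv A B) l -> has_chain (itv A B') l.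
Proof.
move=> BB' [c [Cc cS]]; exists c; split=> // i /Cc[iD AD DB]; split=> //.
exact: subset_trans BB'.
Qed.

Lemma has_chain_bounds A B l : has_chain (itv A B) l -> A `<=` B.
Proof. by move=> [c [Cc _]]; have [_ AD DB] := Cc 0%N isT; exact: subset_trans DB. Qed.

Lemma has_chainS A D B l : is_ideal B -> D `<` B ->
  has_chain (itv A D) l -> has_chain (itv A B) l.+1.
Proof.
move=> iB DB [c [Cc cS]]; exists (fun i => if (i <= l)%N then c i else B).
have AB : A `<=` B.
  by apply: subset_trans (DB.1); apply: (@has_chain_bounds _ _ l); exists c.
split=> i il.
  case: ifP => [/Cc[iD AD Di]|_] //; split=> //; exact: subset_trans (DB.1).
rewrite ltnS in il; rewrite il; case: ltnP => [/cS //|li].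
have [_ _ ciD] := Cc i il.
by split; [exact: subset_trans (DB.1) | move=> /(subset_trans)/(_ ciD)/(DB.2)].
Qed.

Lemma has_chain_pred A B l : has_chain (itv A B) l.+1 ->
  exists D, [/\ is_ideal D, D `<` B & has_chain (itv A D) l].
Proof.
move=> [c [Cc cS]]; exists (c l).
have [iD AD DB] := Cc l (leqnSn l); have [_ _ D'B] := Cc l.+1 (leqnn _).
have [sub nsub] := cS l (leqnn _).
split=> //; first by split=> // /(subset_trans D'B).
exists c; split=> i il; last by apply: cS; exact: leqW.
have [iDi ADi _] := Cc i (leqW il); split=> //.
elim: l il {Cc AD DB D'B iD sub nsub} cS => [|l IH] il cS.
  by move: il; rewrite leqn0 => /eqP ->.
move: il; rewrite leq_eqVlt => /orP[/eqP -> //|il].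
apply: subset_trans (cS l _).1; last by [].
by apply: IH => // j jl; apply: cS; exact: leqW.
Qed.

(** The chain is intersected with B and added to B. Each strict step remains strict in at least one
    of the two resulting chains, whence l <= p + q. *)
Lemma has_chain_split A B C l : is_ideal A -> is_ideal B -> is_ideal C ->
    A `<=` B -> has_chain (itv A C) l ->
  exists p q, [/\ (l <= p + q)%N, has_chain (itv A (B `&` C)) p &
                  has_chain (itv B (addI B C)) q].
Proof.
move=> iA iB + AB; elim: l C => [|l IH] C iC.
  move=> /has_chain_bounds AC; exists 0%N, 0%N; split=> //.
    by apply: has_chain0; [exact: is_idealI | move=> x Ax; split; [exact: AB|exact: AC]].
  by apply: has_chain0; [exact: is_ideal_addI | exact: sub_addIl].
move=> /has_chain_pred[D [iD [DC nCD] /(IH _ iD)[p [q [lpq hp hq]]]]].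
have subI : B `&` D `<=` B `&` C by move=> x [Bx /DC].
have subD : addI B D `<=` addI B C.
  by apply: addI_min; [exact: is_ideal_addI|exact: sub_addIl|
    apply: subset_trans DC _; exact: sub_addIr].
have [IDC|nI] := pselect (B `&` C `<=` B `&` D); last first.
  exists p.+1, q; split; [by rewrite addSn | | exact: has_chainW hq].
  by apply: has_chainS hp; [exact: is_idealI | split].
exists p, q.+1; split; [by rewrite addnS | exact: has_chainW hp|].
apply: has_chainS hq; first exact: is_ideal_addI.
(* Modular law: D inside C with the same intersection with B and the same sum with B would be equal
   to C. *)
split=> // BCD; apply: nCD => x Cx.
have [b Bb [y Dy e]] : addI B D x by apply: BCD; exact: sub_addIr.
have [_] : (B `&` D) b.
  apply: IDC; split=> //; rewrite -(addrK y b) e.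
  by apply: idealB => //; exact: DC.
by rewrite -e => Db; exact: idealD.
Qed.

Lemma has_chain_cat A B C p q : is_ideal C ->
  has_chain (itv A B) p -> has_chain (itv B C) q -> has_chain (itv A C) (p + q).
Proof.
move=> + hp; elim: q C => [|q IH] C iC.
  by rewrite addn0 => /has_chain_bounds BC; exact: has_chainW hp.
move=> /has_chain_pred[D [iD DC /(IH _ iD) hD]].
by rewrite addnS; exact: has_chainS hD.
Qed.

Lemma len_cat A B C p q : is_ideal A -> is_ideal B -> is_ideal C ->
  len A B p -> len B C q -> len A C (p + q).
Proof.
move=> iA iB iC ABp BCq; have AB := has_chain_bounds ABp.1.
have BC := has_chain_bounds BCq.1.
split; first exact: has_chain_cat ABp.1 BCq.1.
move=> /(has_chain_split iA iB iC AB)[p' [q' [lpq hp hq]]].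
have p'p := max_chain_length_le ABp (has_chainW (@subIsetl _ _ _) hp).
have q'q := max_chain_length_le BCq (has_chainW (addI_min iC BC (@subset_refl _ _)) hq).
by have := leq_trans lpq (leq_add p'p q'q); rewrite ltnn.
Qed.

Lemma len_refl A : is_ideal A -> len A A 0.
Proof.
move=> iA; split; first exact: has_chain0.
by move=> /has_chain_pred[D [iD [DA nAD] /has_chain_bounds]].
Qed.

Lemma len_sub A B C l : is_ideal C -> A `<=` B -> B `<=` C -> len A C l ->
  exists p, len B C p /\ (p <= l)%N.
Proof.
move=> iC AB BC ACl.
have bnd q : has_chain (itv B C) q -> (q <= l)%N.
  move=> [c [Cc cS]]; apply: (max_chain_length_le ACl); exists c; split=> // i /Cc[iD BD DC].
  by split=> //; exact: subset_trans BD.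
have ex : exists q, `[< has_chain (itv B C) q >] by exists 0%N; apply/asboolP/has_chain0.
have ub q : `[< has_chain (itv B C) q >] -> (q <= l)%N by move=> /asboolP/bnd.
case: (ex_maxnP ex ub) => p /asboolP hp maxp; exists p; split; last exact: bnd.
by split=> // h; have := maxp p.+1 (asboolT h); rewrite ltnn.
Qed.

(* The isomorphism [K/L = (A + Ky)/A], as an isomorphism of lattices of
   submodules. *)
Lemma len_cyclic A K y l : is_ideal A -> is_ideal K ->
  len [set k | K k /\ A (k * y)] K l -> len A (addI A [set k * y | k in K]) l.
Proof.
move=> iA iK; set L := [set k | _]; set B := addI A _.
pose f D : set R := [set k | K k /\ D (k * y)].
pose g E : set R := addI A [set k * y | k in E].
have if_ D : is_ideal D -> is_ideal (f D).
  by move=> iD; exact: (is_idealI iK (is_ideal_colonl y iD)).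
have ig E : is_ideal E -> is_ideal (g E) by move=> iE; apply: is_ideal_addI => //; exact: is_ideal_scale.
move=> [KL nKL]; split.
  apply: (@has_chain_map _ _ (itv L K) (itv A B) g) KL => [E [iE LE EK]|E E' _ _ EE'|].
  - split; [exact: ig|by apply: sub_addIl; exact: is_ideal_scale|].
    by move=> _ [a Aa [_ [k /EK Kk <-] <-]]; exists a => //; exists (k * y) => //; exists k.
  - by move=> _ [a Aa [_ [k /EE' Kk <-] <-]]; exists a => //; exists (k * y) => //; exists k.
  - move=> E E' [iE LE EK] [iE' LE' EK'] EE' gEE' k Ek.
    have [a Aa [_ [k' E'k' <-] e]] : g E (k * y).
      by apply: gEE'; exists 0; [exact: ideal0|exists (k * y); [exists k|rewrite add0r]].
    rewrite -(subrK k' k); apply: idealD => //; apply: LE; split.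
      by apply: idealB => //; [exact: EK'|exact: EK].
    by rewrite mulrBl -e addrK.
move=> BAl; apply: nKL.
apply: (@has_chain_map _ _ (itv A B) (itv L K) f) BAl => [D [iD AD DB]|D D' _ _ DD'|].
- split; [exact: if_|by move=> k [Kk Ak]; split=> //; exact: AD|by move=> k []].
- by move=> k [Kk /DD' Dk]; split.
- move=> D D' [iD AD DB] [iD' AD' DB'] DD' fDD' x /[dup] D'x /DB'[a Aa [_ [k Kk <-] e]].
  rewrite -e; apply: idealD => //; first exact: AD.
  suff [] : f D k by [].
  apply: fDD'; split=> //; rewrite -(addKr a (k * y)) e addrC.
  by apply: idealB => //; exact: AD'.
Qed.

End Length.

(** * Finitely generated ideals and finite length *)

Section FiniteLength.
Variable R : comNzRingType.
Implicit Types (A B K L m : set R) (a s : seq R) (k x y : R).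

Definition dot a s : R := \sum_(p <- zip a s) p.1 * p.2.

Lemma dot0s s : dot [::] s = 0.
Proof. by rewrite /dot; case: s => [|y s] /=; rewrite big_nil. Qed.

Lemma dots0 a : dot a [::] = 0.
Proof. by rewrite /dot; case: a => [|k a] /=; rewrite big_nil. Qed.

Lemma dot_cons k a y s : dot (k :: a) (y :: s) = k * y + dot a s.
Proof. by rewrite /dot /= big_cons. Qed.

Lemma dot_cat a1 a2 s1 s2 : size a1 = size s1 ->
  dot (a1 ++ a2) (s1 ++ s2) = dot a1 s1 + dot a2 s2.
Proof. by move=> e; rewrite /dot zip_cat // big_cat. Qed.

Lemma dot_mulr z a s : dot a [seq z * y | y <- s] = z * dot a s.
Proof.
elim: s a => [|y s IH] [|k a] /=; rewrite ?dot0s ?dots0 ?mulr0 //.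
by rewrite !dot_cons IH; ring.
Qed.

Lemma dot_mull z a s : dot [seq z * k | k <- a] s = z * dot a s.
Proof.
elim: s a => [|y s IH] [|k a] /=; rewrite ?dot0s ?dots0 ?mulr0 //.
by rewrite !dot_cons IH; ring.
Qed.

Lemma ideal_dot A a s : is_ideal A -> size a = size s ->
  (forall k y, k \in a -> y \in s -> A (k * y)) -> A (dot a s).
Proof.
move=> iA; elim: s a => [|y s IH] [|k a] //= => [_ _|[e] h].
  by rewrite dots0; exact: ideal0.
rewrite dot_cons; apply: idealD => //; first by apply: h; rewrite inE eqxx.
by apply: IH => // k' y' ka ys; apply: h; rewrite inE ?ka ?ys orbT.
Qed.

Lemma mul_gen_cons K y s x : is_ideal K ->
  ideal_mul K (gen (y :: s)) x <->
  exists2 k, K k & ideal_mul K (gen s) (x - k * y).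
Proof.
move=> iK; split=> [|[k Kk h]]; last first.
  rewrite -(subrK (k * y) x); apply: (idealD (is_ideal_mul _ _)).
    by apply: mulSr h; apply: gen_sub => u us; rewrite inE us orbT.
  by apply: mem_mul => //; apply: mem_gen; rewrite inE eqxx.
apply: (@mul_min _ _ _ [set x | exists2 k, K k & ideal_mul K (gen s) (x - k * y)]).
  split.
  - by exists 0; [exact: ideal0|rewrite mul0r subr0; exact: (ideal0 (is_ideal_mul _ _))].
  - move=> u v [a Ka ga] [b Kb gb]; exists (a + b); first exact: idealD.
    rewrite (_ : _ - _ = (u - a * y) + (v - b * y)); last by ring.
    exact: (idealD (is_ideal_mul _ _)).
  - move=> r u [a Ka ga]; exists (r * a); first exact: idealMl.
    rewrite (_ : _ - _ = r * (u - a * y)); last by ring.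
    exact: (idealMl (is_ideal_mul _ _)).
move=> k u Kk /gen_cons[r gr]; exists (k * r); first exact: idealMr.
by rewrite -mulrA -mulrBr; exact: mem_mul.
Qed.

Lemma mul_genP K s x : is_ideal K -> ideal_mul K (gen s) x ->
  exists a, [/\ size a = size s, forall k, k \in a -> K k & x = dot a s].
Proof.
move=> iK; elim: s x => [|y s IH] x.
  move=> h; exists [::]; split=> //; rewrite dots0.
  exact: gen_nil (mul_subr (is_ideal_gen _) h).
move=> /(mul_gen_cons _ _ _ iK)[k Kk /IH[a [sa Ka e]]].
exists (k :: a); split; first by rewrite /= sa.
  by move=> k'; rewrite inE => /orP[/eqP ->|/Ka].
by rewrite dot_cons -e addrC subrK.
Qed.

Lemma genP s x : gen s x -> exists2 a, size a = size s & x = dot a s.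
Proof.
rewrite -(mulTI (is_ideal_gen s)) => /(mul_genP (is_idealT R))[a [sa _ ->]].
by exists a.
Qed.

Lemma gen_dot a s : size a = size s -> gen s (dot a s).
Proof.
move=> e; apply: (ideal_dot (is_ideal_gen s)) => // k y _ ys.
by apply: (idealMl (is_ideal_gen s)); exact: mem_gen.
Qed.

Lemma addI_mul_gen_cons A K y s : is_ideal A -> is_ideal K ->
  addI A (ideal_mul K (gen (y :: s))) =
  addI (addI A (ideal_mul K (gen s))) [set k * y | k in K].
Proof.
move=> iA iK; apply/seteqP; split.
  move=> _ [a Aa [b /(mul_gen_cons _ _ _ iK)[k Kk h] <-]].
  exists (a + (b - k * y)); first by exists a => //; exists (b - k * y).
  by exists (k * y); [exists k | ring].
move=> _ [_ [a Aa [b h <-]] [_ [k Kk <-] <-]].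
exists a => //; exists (b + k * y); last by ring.
by apply/mul_gen_cons => //; exists k; rewrite // addrK.
Qed.

Lemma addI_mul_gen_nil A K : is_ideal A -> addI A (ideal_mul K (gen [::])) = A.
Proof.
move=> iA; apply/seteqP; split; last exact: sub_addIl.
apply: addI_min => // x /(mul_subr (is_ideal_gen _))/gen_nil ->; exact: ideal0.
Qed.

(** Modulo A the elements of s are killed by L, and every relation among them has its coefficients
    in L. The quotient is therefore a direct sum of [size s] copies of K/L, built up one cyclic
    summand at a time. *)
Lemma len_free A K L s r : is_ideal A -> is_ideal K -> L `<=` K ->
  (forall k y, L k -> y \in s -> A (k * y)) ->
  (forall a, size a = size s -> A (dot a s) -> forall k, k \in a -> L k) ->
  len L K r -> len A (addI A (ideal_mul K (gen s))) (size s * r).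
Proof.
move=> iA iK LK; elim: s => [|y s IH] Ls free LKr.
  by rewrite addI_mul_gen_nil //; exact: len_refl.
have iA' : is_ideal (addI A (ideal_mul K (gen s))) by exact: is_ideal_addI.
rewrite addI_mul_gen_cons //= mulSn addnC; apply: len_cat (IH _ _ LKr) _ => //.
- by apply: is_ideal_addI => //; exact: is_ideal_scale.
- by move=> k u Lk us; apply: Ls; rewrite // inE us orbT.
- move=> a sa Aa k ka; apply: (free (0 :: a)); rewrite /= ?sa ?dot_cons ?mul0r ?add0r //.
  by rewrite inE ka orbT.
apply: len_cyclic => //; rewrite (_ : [set k | _] = L) //; apply/seteqP; split.
  move=> k [Kk [u Au [v /(idealN (is_ideal_mul _ _)) /(mul_genP iK)[a [sa _ e]] euv]]].
  apply: (free (k :: a)); rewrite ?inE ?eqxx //= ?sa // dot_cons -e -euv.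
  by rewrite addrK.
move=> k Lk; split; first exact: LK.
by apply: sub_addIl => //; apply: Ls; rewrite // inE eqxx.
Qed.

Lemma len_maximal m : maximal_ideal m -> len m setT 1.
Proof.
move=> [im m1 mmax]; split.
  apply: (has_chainS (D := m)) => //; last exact: has_chain0.
  by split=> // /(_ 1 I).
move=> /has_chain_pred[D [iD [_ nTD] /has_chain_pred[D' [iD' [D'D nDD'] h]]]].
have mD' := has_chain_bounds h.
apply: nDD'; rewrite (mmax D) //; last exact: subset_trans D'D.
by move=> D1; apply: nTD; rewrite (ideal1 iD D1).
Qed.

(** The quotient is a vector space over R/m spanned by s; each new generator adds a cyclic module
    killed by m, of length at most 1. *)
Lemma len_gens m A s : maximal_ideal m -> is_ideal A ->
  (forall k y, m k -> y \in s -> A (k * y)) ->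
  exists l, len A (addI A (gen s)) l /\ (l <= size s)%N.
Proof.
move=> mm iA; rewrite -(mulTI (is_ideal_gen s)); elim: s => [|y s IH] ms.
  by exists 0%N; rewrite addI_mul_gen_nil //; split=> //; exact: len_refl.
have [|l [hl ls]] := IH; first by move=> k u mk us; apply: ms; rewrite // inE us orbT.
set A' := addI A _ in hl; have iA' : is_ideal A' by exact: is_ideal_addI.
have iL : is_ideal [set k | setT k /\ A' (k * y)].
  by apply: (is_idealI (is_idealT R)); exact: is_ideal_colonl.
have [p [hp p1]] : exists p, len [set k | setT k /\ A' (k * y)] setT p /\ (p <= 1)%N.
  apply: len_sub (len_maximal mm) => // k mk; split=> //.
  by apply: sub_addIl => //; apply: ms; rewrite // inE eqxx.
exists (l + p)%N; split; last by rewrite /= -addn1 leq_add.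
rewrite addI_mul_gen_cons //; apply: len_cat hl (len_cyclic _ _ hp) => //.
by apply: is_ideal_addI => //; exact: is_ideal_scale.
Qed.

Lemma len_mul_maximal m A : noetherian R -> maximal_ideal m -> is_ideal A ->
  exists l, len (ideal_mul m A) A l.
Proof.
move=> noeR mm iA; have [s e] := noeR A iA.
have [|l [h _]] := @len_gens m (ideal_mul m A) s mm (is_ideal_mul _ _).
  by move=> k y mk ys; apply: mem_mul; rewrite // e; exact: mem_gen.
exists l; rewrite (_ : addI _ _ = A) // in h; apply/seteqP; split.
  by apply: addI_min => //; [exact: mul_subr | rewrite e].
by rewrite {1}e; exact: sub_addIr.
Qed.

Lemma len_exp_maximal m A n : noetherian R -> maximal_ideal m -> is_ideal A ->
  exists l, len (ideal_mul (ideal_exp m n) A) A l.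
Proof.
move=> noeR mm iA; elim: n => [|n [l IH]].
  by exists 0%N; rewrite mulTI //; exact: len_refl.
have [p hp] := len_mul_maximal noeR mm (is_ideal_mul (ideal_exp m n) A).
by exists (p + l)%N; rewrite expS -mulIA; exact: len_cat hp IH.
Qed.

End FiniteLength.

(** * Primes and regular sequences *)

Section PrimesAvoiding.
Variable R : comNzRingType.
Implicit Types (A B P Q J m : set R) (S : set R) (s : seq R) (x y z : R).

Lemma ideal_avoiding A S : is_ideal A -> (forall x, S x -> ~ A x) ->
  exists Q, [/\ is_ideal Q, A `<=` Q, forall x, S x -> ~ Q x &
    forall B, is_ideal B -> Q `<=` B -> (forall x, S x -> ~ B x) -> B = Q].
Proof.
move=> iA AS.
(* The empty chain must satisfy the predicate too, whence the union with A. *)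
pose F X := is_ideal (X `|` A) /\ forall x, S x -> ~ (X `|` A) x.
have [G GF Gtot|X [[iXA XAS] Xmax]] := @Zorn_bigcup _ F.
  split=> [|x Sx [[X GX Xx]|Ax]]; last exact: AS Ax.
    split.
    - by right; exact: ideal0.
    - have both X x y : G X -> (X `|` A) x -> (X `|` A) y ->
        (\bigcup_(X in G) X `|` A) (x + y).
        move=> GX Xx Xy; have [iXA _] := GF _ GX.
        by case: (idealD iXA Xx Xy) => [Xxy|Axy]; [left; exists X | right].
      move=> x y [[X GX Xx]|Ax] [[Y GY Yy]|Ay].
      + have [XY|YX] := Gtot _ _ GX GY.
          by apply: (both Y) => //; left => //; exact: XY.
        by apply: (both X) => //; left => //; exact: YX.
      + by apply: (both X) => //; [left|right].
      + by apply: (both Y) => //; [right|left].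
      + by right; exact: idealD.
    - move=> r x [[X GX Xx]|Ax]; last by right; exact: idealMl.
      have [iXA _] := GF _ GX; have XAx : (X `|` A) x by left.
      by case: (idealMl (r := r) iXA XAx) => [Xrx|Arx]; [left; exists X | right].
  by have [_ /(_ x Sx)] := GF _ GX; apply; left.
exists (X `|` A); split=> // B iB XAB BS.
apply: contrapT => nBX.
have BA : B `|` A = B.
  by apply/seteqP; split=> x; [case=> // Ax; apply: XAB; right | left].
apply: (Xmax B); last by rewrite /F BA.
split=> [x Xx|BX]; first by apply: XAB; left.
by apply: nBX; apply/seteqP; split=> // x /BX; left.
Qed.

(** An ideal maximal among those disjoint from a multiplicative set is prime: if x and y lie outside
    Q, then Q + Rx and Q + Ry both meet S, and the product of the two common elements lies in Q +
    Rxy. *)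
Lemma prime_avoiding A S : is_ideal A -> S 1 ->
    (forall x y, S x -> S y -> S (x * y)) -> (forall x, S x -> ~ A x) ->
  exists Q, [/\ prime_ideal Q, A `<=` Q & forall x, S x -> ~ Q x].
Proof.
move=> iA S1 SM /(ideal_avoiding iA)[Q [iQ AQ QS Qmax]].
exists Q; split=> //; split=> // [|x y Qxy]; first exact: QS.
apply: contrapT => /not_orP[nQx nQy].
have meet u : ~ Q u -> exists2 t, S t & exists2 r, True & Q (t - r * u).
  move=> nQu; pose B := addI Q [set r * u | r in setT].
  have iu := is_ideal_scale u (is_idealT R).
  have iB : is_ideal B by exact: is_ideal_addI.
  apply: contrapT => nex; apply: nQu; rewrite -(Qmax B) //.
  - by apply: sub_addIr => //; exists 1; rewrite ?mul1r.
  - exact: sub_addIl.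
  - move=> t St [q Qq [_ [r _ <-] e]]; apply: nex; exists t => //; exists r => //.
    by rewrite -e addrK.
have [t St [r _ Qt]] := meet x nQx; have [t' St' [r' _ Qt']] := meet y nQy.
apply: (QS (t * t')); first exact: SM.
rewrite (_ : t * t' = (t - r * x) * t' + (t' - r' * y) * (r * x) + (r * r') * (x * y)).
  by apply: idealD => //; [apply: idealD => //; exact: idealMr | exact: idealMl].
ring.
Qed.

Lemma local_sub m A : local_ring m -> is_ideal A -> ~ A 1 -> A `<=` m.
Proof.
move=> [_ uniqm] iA A1.
have [|Q [iQ AQ Q1 Qmax]] := @ideal_avoiding A [set 1] iA; first by move=> _ ->.
rewrite -(uniqm Q) //; split=> //; first exact: Q1.
by move=> B iB B1 QB; apply: Qmax => // _ ->.
Qed.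

Lemma local_unit m x : local_ring m -> ~ m x -> exists y, y * x = 1.
Proof.
move=> lm nmx; apply: contrapT => nex; apply: nmx.
apply: (local_sub lm (is_ideal_scale x (is_idealT R))); last by exists 1; rewrite ?mul1r.
by move=> [y _ e]; apply: nex; exists y.
Qed.

Lemma maximal_prime m : maximal_ideal m -> prime_ideal m.
Proof.
move=> [im m1 mmax].
have [|x y -> ->|x ->|Q [[iQ Q1 QM] mQ _]] := @prime_avoiding m [set 1] im => //.
  by rewrite mulr1.
- by rewrite -(mmax Q).
Qed.

(** The multiplicative set of the t z^k with t outside P misses the preceding generators, because
    powers of z cancel modulo them. A prime avoiding it lies inside P and does not contain z, so it
    is strictly smaller. *)
Lemma regular_seq_nth_prime s i P : regular_sequence s -> (i < size s)%N ->
    prime_ideal P -> gen (take i.+1 s) `<=` P ->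
  exists Q, [/\ prime_ideal Q, gen (take i s) `<=` Q & Q `<` P].
Proof.
move=> [_ reg] il [iP P1 PM] sP; set z := s`_i.
have Pz : P z.
  by apply: sP; apply: mem_gen; rewrite (take_nth 0 il) // mem_rcons inE eqxx.
pose S := [set x : R | exists k, exists2 t, ~ P t & x = t * z ^+ k].
have [|||x [k [t nPt ->]]|Q [pQ sQ QS]] := @prime_avoiding (gen (take i s)) S.
- exact: is_ideal_gen.
- by exists 0%N, 1; rewrite ?mul1r.
- move=> _ _ [k [t nPt ->]] [k' [t' nPt' ->]]; exists (k + k')%N, (t * t').
    by move=> /PM[].
  by rewrite exprD; ring.
- elim: k => [|k IH].
    rewrite mulr1 => ht; apply/nPt/sP; apply: gen_sub ht => u.
    by rewrite (take_nth 0 il) // mem_rcons inE => ->; rewrite orbT.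
  by rewrite exprS mulrCA => /(reg _ _ il).
exists Q; split=> //; split=> [x Qx|PQ].
  by apply: contrapT => nPx; apply: (QS x) => //; exists 0%N, x; rewrite ?mulr1.
by apply: (QS z); [exists 1%N, 1; rewrite ?mul1r | exact: PQ].
Qed.

Lemma regular_seq_chain s i P : regular_sequence s -> (i <= size s)%N ->
    prime_ideal P -> gen (take i s) `<=` P ->
  exists c : nat -> set R, [/\ forall j, (j <= i)%N -> prime_ideal (c j),
    forall j, (j < i)%N -> c j `<` c j.+1 & c i = P].
Proof.
move=> regs; elim: i P => [|i IH] P il pP sP; first by exists (fun=> P); split.
have [Q [pQ sQ QP]] := regular_seq_nth_prime regs il pP sP.
have [c [cp cS ci]] := IH Q (ltnW il) pQ sQ.
exists (fun j => if (j <= i)%N then c j else P); split=> [j _|j|]; last by rewrite ltnn.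
  by case: ifP => // /cp.
rewrite ltnS => ji; rewrite ji; case: ltnP => [/cS //|ij].
by rewrite (_ : j = i) ?ci //; apply/eqP; rewrite eqn_leq ji.
Qed.

(** The regular sequence produces a chain of length [size s] ending at P. If P were not m, appending
    m would exceed the dimension. *)
Lemma regular_seq_prime_max s m P : local_ring m -> krull_dim R (size s) ->
  regular_sequence s -> prime_ideal P -> gen s `<=` P -> P = m.
Proof.
move=> lm [_ nch] regs pP sP; apply: contrapT => nPm; apply: nch.
have [|c [cp cS ci]] := regular_seq_chain regs (leqnn _) pP; first by rewrite take_size.
exists (fun j => if (j <= size s)%N then c j else m); split=> [j _|j].
  by case: ifP => [/cp //|_]; apply: maximal_prime; case: lm.
rewrite ltnS => ji; rewrite ji; case: ltnP => [/cS //|ij].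
have -> : j = size s by apply/eqP; rewrite eqn_leq ji.
rewrite ci; case: pP => iP P1 _; have Pm := local_sub lm iP P1.
by split=> // mP; apply: nPm; apply/seteqP.
Qed.

Lemma exp_gen_cons x s n :
  ideal_exp (gen (x :: s)) n.+1 `<=`
  addI (ideal_exp (gen s) n.+1) [set r * x | r in ideal_exp (gen (x :: s)) n].
Proof.
elim: n => [|n IH].
  rewrite !exp1 // => y /gen_cons[r gr].
  by exists (y - r * x) => //; exists (r * x); [exists r | rewrite subrK].
rewrite expS; apply: mul_min => [|u v /gen_cons[r gr] xv].
  by apply: is_ideal_addI => //; exact: is_ideal_scale.
have [v1 sv1 [_ [v2 xv2 <-] ev]] := IH _ xv.
exists ((u - r * x) * v1); first by apply: mem_mul.
exists (((u - r * x) * v2 + r * v) * x); last by rewrite -ev; ring.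
exists ((u - r * x) * v2 + r * v) => //.
apply: (idealD (ideal_exp_ideal _ _)); last exact: (idealMl (ideal_exp_ideal _ _)).
rewrite expS; apply: mem_mul => //.
by apply: gen_sub gr => w ws; rewrite inE ws orbT.
Qed.

(** Finitely many generators, each nilpotent modulo J, generate an ideal that is nilpotent modulo
    J. *)
Lemma exp_gen_sub J s : is_ideal J ->
  (forall x, x \in s -> exists k, J (x ^+ k)) -> exists c, ideal_exp (gen s) c `<=` J.
Proof.
move=> iJ; elim: s => [|x s IH] sJ.
  exists 1%N; rewrite exp1 // => y /gen_nil ->; exact: ideal0.
have [|c hc] := IH; first by move=> y ys; apply: sJ; rewrite inE ys orbT.
have [|k Jk] := sJ x; first by rewrite inE eqxx.
(* A product of c + j generators either has at least c factors from s, and then lies in J, or is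
   divisible by x^j. *)
suff step j : ideal_exp (gen (x :: s)) (c + j) `<=` addI J [set r * x ^+ j | r in setT].
  exists (c + k)%N; apply: subset_trans (step k) _; apply: addI_min => // _ [r _ <-].
  exact: idealMl.
elim: j => [|j IHj].
  by move=> y _; exists 0; [exact: ideal0|exists y; [exists y; rewrite ?mulr1|rewrite add0r]].
rewrite addnS => _ /exp_gen_cons[u su [_ [v xv <-] <-]].
have [w Jw [_ [r _ <-] <-]] := IHj _ xv.
exists (u + w * x).
  apply: idealD => //; last exact: idealMr.
  by apply: hc; apply: exp_sub su; rewrite -addnS leq_addr.
by exists (r * x ^+ j.+1); [exists r | rewrite exprSr; ring].
Qed.

Lemma regular_seq_exp_sub s m : noetherian R -> local_ring m ->
    krull_dim R (size s) -> regular_sequence s ->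
  exists c, ideal_exp m c `<=` gen s.
Proof.
move=> noeR lm dimR regs; have [t e] := noeR m (let: conj (And3 im _ _) _ := lm in im).
rewrite e; apply: exp_gen_sub => // x xt; apply: contrapT => nex.
have [||u v|u|Q [pQ sQ QS]] := @prime_avoiding (gen s) [set y | exists k, y = x ^+ k].
- exact: is_ideal_gen.
- by exists 0%N.
- by move=> [k ->] [k' ->]; exists (k + k')%N; rewrite exprD.
- by move=> [k ->] sk; apply: nex; exists k.
apply: (QS x); first by exists 1%N.
by rewrite (regular_seq_prime_max lm dimR regs pQ sQ) e; exact: mem_gen.
Qed.

End PrimesAvoiding.

(** * Quasi-regularity *)

Section Monomials.
Variable R : comNzRingType.
Implicit Types (K : set R) (a s : seq R) (k x y z : R) (n : nat).

(** The monomials without z come first, then z times those of one degree less, so that a coefficient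
    list splits by [take] and [drop] along the induction on s. In degree 1 this order reverses s. *)
Fixpoint monomials s : nat -> seq R :=
  if s is z :: s' then
    fix monz n := if n is n'.+1 then monomials s' n ++ [seq z * y | y <- monz n'] else [:: 1]
  else fun n => if n is 0 then [:: 1] else [::].

Lemma monomials0 s : monomials s 0 = [:: 1]. Proof. by case: s. Qed.

Lemma monomialsS z s n :
  monomials (z :: s) n.+1 = monomials s n.+1 ++ [seq z * y | y <- monomials (z :: s) n].
Proof. by []. Qed.

Lemma monomials1 s : monomials s 1 = rev s.
Proof.
by elim: s => // z s IH; rewrite monomialsS IH monomials0 /= mulr1 rev_cons cats1.
Qed.

Lemma size_monomials s n : size (monomials s n) = 'C((n + size s).-1, n).
Proof.
elim: s n => [|z s IH] [|n]; rewrite ?monomials0 ?bin0 //.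
  by rewrite addn0 bin_small.
elim: n => [|n IHn]; first by rewrite monomialsS size_cat size_map IH monomials0 !bin1 /= addn1.
by rewrite monomialsS size_cat size_map IH IHn /= !addSn !addnS /= binS.
Qed.

Lemma gen_consr z s : gen s `<=` gen (z :: s).
Proof. by apply: gen_sub => x xs; rewrite inE xs orbT. Qed.

Lemma gen_rev s : gen (rev s) = gen s.
Proof. by apply: eq_gen => x; rewrite mem_rev. Qed.

Lemma gen_monomials s n : gen (monomials s n) = ideal_exp (gen s) n.
Proof.
have gen1 : gen [:: 1] = setT :> set R.
  by apply: (ideal1 (is_ideal_gen _)); apply: mem_gen; rewrite inE eqxx.
elim: s n => [|z s IH] [|n]; rewrite ?monomials0 ?gen1 //.
  apply/seteqP; split=> x; first by move=> /gen_nil ->; exact: (ideal0 (ideal_exp_ideal _ _)).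
  by move=> /(mul_subl (is_ideal_gen _))/gen_nil ->; exact: (ideal0 (is_ideal_gen _)).
elim: n => [|n IHn].
  by rewrite monomials1 gen_rev exp1.
rewrite monomialsS gen_cat IH; apply/seteqP; split.
  apply: addI_min => //; first by apply: expSub; exact: gen_consr.
  apply: gen_min => // _ /mapP[y /mem_gen My ->]; rewrite expS; apply: mem_mul.
    by apply: mem_gen; rewrite inE eqxx.
  by rewrite -IHn.
apply: subset_trans (@exp_gen_cons _ _ _ _) _; apply: addI_min.
- exact: is_ideal_addI.
- exact: sub_addIl.
- move=> _ [r + <-]; rewrite -IHn => /genP[a sa ->]; apply: sub_addIr => //.
  by rewrite mulrC -dot_mulr; apply: gen_dot; rewrite size_map.
Qed.

Lemma dot_add a b s : size a = size b ->
  dot [seq p.1 + p.2 | p <- zip a b] s = dot a s + dot b s.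
Proof.
elim: s a b => [|y s IH] [|k a] [|l b] //=; rewrite ?dots0 ?dot0s ?addr0 //.
by case=> e; rewrite !dot_cons IH //; ring.
Qed.

(* Regularity of the sequence read from right to left, as required by the
   recursion in [monomials]. *)
Fixpoint rev_regular s : Prop :=
  if s is z :: s' then
    rev_regular s' /\ forall x, gen s' (z * x) -> gen s' x
  else True.

Lemma rev_regularP s : regular_sequence s -> rev_regular (rev s).
Proof.
move=> [_ reg]; suff h i : (i <= size s)%N -> rev_regular (rev (take i s)).
  by have := h _ (leqnn _); rewrite take_size.
elim: i => [|i IH] il; first by rewrite take0.
rewrite (take_nth 0 il) rev_rcons /=; split; first exact/IH/ltnW.
by move=> x; rewrite gen_rev; exact: reg.
Qed.

(** Linear independence of the degree-n monomials over R/(s) in the n-th graded piece of the powers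
    of (s). *)
Definition monomials_free s n : Prop := forall a, size a = size (monomials s n) ->
  ideal_exp (gen s) n.+1 (dot a (monomials s n)) -> forall k, k \in a -> gen s k.

Lemma monomials_free0 s : monomials_free s 0.
Proof.
move=> [|k [|? ?]]; rewrite monomials0 // => _.
rewrite dot_cons dots0 addr0 mulr1 exp1 // => sk k'; rewrite inE => /eqP -> //.
Qed.

(** The graded pieces (s)^n/(s)^(n+1) are free over R/(s), so an element regular on R/(s) is regular
    on each of them, hence on R/(s)^n. *)
Lemma regular_exp s z n x : (forall n, monomials_free s n) ->
  (forall x, gen s (z * x) -> gen s x) ->
  ideal_exp (gen s) n (z * x) -> ideal_exp (gen s) n x.
Proof.
move=> free reg; elim: n x => // n IH x zx.
have : ideal_exp (gen s) n x by apply: IH; exact: exp_sub zx.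
rewrite -gen_monomials => /genP[c sc ex]; rewrite ex expS.
apply: (ideal_dot (is_ideal_mul _ _)) => // k y kc My; apply: mem_mul; last first.
  by rewrite -gen_monomials; exact: mem_gen.
apply: reg; apply: (free n [seq z * k | k <- c]); first by rewrite size_map.
  by rewrite dot_mull -ex.
exact: map_f.
Qed.

(* Quasi-regularity: the associated graded ring of the ideal is a polynomial
   ring. *)
Lemma regular_monomials_free s n : rev_regular s -> monomials_free s n.
Proof.
elim: s n => [|z s IHs] [|n] reg; try exact: monomials_free0.
  by move=> [|? ?].
case: reg => regs regz; have free j := IHs j regs.
elim: n.+1 => [|{}n IHn]; first exact: monomials_free0.
move=> a; rewrite monomialsS size_cat size_map.
set M := monomials s n.+1; set N := monomials (z :: s) n => sa.
have s1 : size (take (size M) a) = size M by rewrite size_takel // sa leq_addr.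
have s2 : size (drop (size M) a) = size N by rewrite size_drop sa addKn.
rewrite -(cat_take_drop (size M) a); move: (take _ a) (drop _ a) s1 s2 => a1 a2 s1 s2.
rewrite dot_cat // dot_mulr => /exp_gen_cons[u su [_ [e ze <-] eq_u]].
(* The relation reads [dot a1 M + z * dot a2 N = u + e * z], with u in (s)^(n+2) and e in (z,
   s)^(n+1). Hence z times this difference lies in (s)^(n+1), modulo which z cancels. *)
have sy : ideal_exp (gen s) n.+1 (dot a2 N - e).
  apply: (regular_exp free regz); rewrite (_ : _ * _ = u - dot a1 M).
    apply: (idealB (ideal_exp_ideal _ _)); first exact: exp_sub su.
    by rewrite -gen_monomials; exact: gen_dot.
  by rewrite mulrBr (mulrC z e) -[z * _](addKr (dot a1 M)) -eq_u; ring.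
have za2 : forall k, k \in a2 -> gen (z :: s) k.
  apply: IHn => //; rewrite -(subrK e (dot a2 _)).
  apply: (idealD (ideal_exp_ideal _ _)) => //; exact: expSub (@gen_consr _ _) _ sy.
(* With [dot a2 N - e = dot c M] the relation becomes a relation over s alone, with coefficients a1
   + zc and value u. These coefficients then lie in (s), which puts a1 in (z, s). *)
move: sy; rewrite -gen_monomials => /genP[c sc ec].
have sac : size a1 = size c by rewrite s1 sc.
pose b := [seq p.1 + p.2 | p <- zip a1 [seq z * k | k <- c]].
have sb : size b = size M by rewrite size_map size_zip size_map -sac minnn.
have freeb : forall k, k \in b -> gen s k.
  apply: (free n.+1) => //; rewrite dot_add ?size_map // dot_mull -ec.
  suff -> : dot a1 (monomials s n.+1) + z * (dot a2 N - e) = u by [].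
  by rewrite mulrBr addrA -eq_u; ring.
move=> k; rewrite mem_cat => /orP[ka1|/za2 //]; set i := index k a1.
have ia1 : (i < size a1)%N by rewrite index_mem.
apply/gen_cons; exists (- c`_i); apply: freeb.
rewrite (_ : _ - _ = b`_i); first by rewrite mem_nth // sb -s1.
rewrite (nth_map (0, 0)) ?size_zip ?size_map -?sac ?minnn //.
rewrite nth_zip ?size_map //= (nth_map 0) -?sac // nth_index //; ring.
Qed.

(** By quasi-regularity K J^n/J^(n+1), with J = (s), is a sum of copies of K/J indexed by the
    monomials of degree n. It is applied with K the unit ideal and with K the link I. *)
Lemma len_monomials s K n r : rev_regular s -> is_ideal K -> gen s `<=` K ->
    len (gen s) K r ->
  len (ideal_exp (gen s) n.+1) (ideal_mul K (ideal_exp (gen s) n))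
      ('C((n + size s).-1, n) * r).
Proof.
move=> regs iK sK hr; rewrite -size_monomials.
rewrite [X in len _ X](_ : _ =
    addI (ideal_exp (gen s) n.+1) (ideal_mul K (gen (monomials s n)))).
  apply: (len_free (L := gen s)) => //; last exact: regular_monomials_free.
  move=> k y sk My; rewrite expS; apply: mem_mul => //.
  by rewrite -gen_monomials; exact: mem_gen.
rewrite gen_monomials; apply/seteqP; split; first exact: sub_addIr.
by apply: addI_min => //; exact: mulSl.
Qed.

End Monomials.

(** * Growth of polynomials *)

Section BinomialPolynomials.
Implicit Types (n d : nat).

Definition binomial_poly d : {poly rat} :=
  (d`!)%:R^-1 *: \prod_(j < d) ('X + j%:R%:P).

Lemma rising_factorial n d : ('C((n + d).-1, d) * d`! = \prod_(j < d) (n + j))%N.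
Proof.
rewrite bin_ffact; elim: d => [|d IH]; first by rewrite big_ord0.
rewrite big_ord_recr /= -IH addnS /=; case: (n + d)%N => [|k].
  by rewrite muln0.
by rewrite ffactSS mulnC.
Qed.

Lemma binomial_polyE d n : (binomial_poly d).[n%:R] = 'C((n + d).-1, d)%:R.
Proof.
rewrite /binomial_poly hornerZ horner_prod.
have -> : \prod_(j < d) ('X + j%:R%:P).[n%:R] = (\prod_(j < d) (n + j))%N%:R :> rat.
  by rewrite natr_prod; apply: eq_bigr => j _; rewrite !hornerE natrD.
by rewrite -rising_factorial natrM mulrC mulfK // pnatr_eq0 -lt0n fact_gt0.
Qed.

Lemma size_binomial_poly d : (size (binomial_poly d) <= d.+1)%N.
Proof.
apply: leq_trans (size_scale_leq _ _) _; elim: d => [|d IH].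
  by rewrite big_ord0 size_poly1.
rewrite big_ord_recr /=; apply: leq_trans (size_polyMleq _ _) _.
by rewrite size_XaddC addn2.
Qed.

(** The hockey-stick identity; for d = 0 it fails at n = 0. *)
Lemma sum_binomial n d : (0 < d)%N ->
  (\sum_(t < n) 'C((t + d).-1, t) = 'C((n + d).-1, d))%N.
Proof.
case: d => // d _; elim: n => [|n IH]; first by rewrite big_ord0 bin_small.
rewrite big_ord_recr /= IH !addnS /= binS; congr (_ + _)%N.
by rewrite -bin_sub ?leq_addr // addKn.
Qed.

Lemma leq_exp_rising n d : (n ^ d <= 'C((n + d).-1, d) * d`!)%N.
Proof.
rewrite rising_factorial; elim: d => [|d IH]; first by rewrite big_ord0.
by rewrite big_ord_recr /= expnSr leq_mul // leq_addr.
Qed.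

(** A polynomial of degree below D cannot dominate n^D. Values at multiples of c suffice, since the
    length estimates are obtained only along such multiples. *)
Lemma poly_growth (P : {poly rat}) (D c b n0 : nat) : (0 < c)%N ->
    (forall n, (n0 <= n)%N -> (n ^ D)%:R <= b%:R * P.[(c * n)%:R]) ->
  (D < size P)%N.
Proof.
move=> c0 grow; rewrite ltnNge; apply/negP => PD.
have [P0|Pn0] := eqVneq P 0.
  have := grow n0.+1 (leqnSn _).
  by rewrite P0 horner0 mulr0 lern0 expn_eq0.
case: D PD grow => [|D] PD grow; first by rewrite leqn0 size_poly_eq0 (negPf Pn0) in PD.
pose S : rat := \sum_(i < size P) `|P`_i|.
(* D is now one less than the exponent in the statement. For x >= 1 the value P(x) is at most S x^D,
   so b P(cn) <= B n^D, which is smaller than n^(D+1) as soon as n > B. *)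
pose B : rat := b%:R * (S * c%:R ^+ D).
have S0 : 0 <= S by apply: sumr_ge0 => i _; exact: normr_ge0.
pose n := (Num.bound B + n0).+1.
have nB : B < n%:R.
  apply: lt_le_trans (archi_boundP _) _; last by rewrite ler_nat /n; lia.
  by rewrite /B !mulr_ge0 ?exprn_ge0.
have := grow n (leqW (leq_addl _ _)); apply/negP; rewrite -ltNge.
have x1 : 1 <= (c * n)%:R :> rat by rewrite ler1n muln_gt0 c0.
apply: (@le_lt_trans _ _ (b%:R * (S * (c * n)%:R ^+ D))).
  rewrite ler_wpM2l // horner_coef mulr_suml; apply: ler_sum => i _.
  apply: le_trans (ler_norm _) _; rewrite normrM ler_wpM2l // normrX ger0_norm //.
  by apply: ler_weXn2l => //; rewrite -ltnS; exact: leq_trans PD.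
rewrite natrM exprMn !mulrA -(mulrA b%:R) -/B expnS natrM natrX.
by rewrite ltr_pM2r // -natrX ltr0n expn_gt0.
Qed.

End BinomialPolynomials.

(** * Colengths of powers and minimal generators of a parameter ideal *)

Section Colengths.
Variable R : comNzRingType.
Implicit Types (A I J K m : set R) (a s t : seq R) (k u w x y z : R).

Lemma len_exp_regular s r n : (0 < size s)%N -> regular_sequence s ->
    len (gen s) setT r ->
  len (ideal_exp (gen s) n) setT ('C((n + size s).-1, size s) * r).
Proof.
move=> s0 /rev_regularP regs hr; rewrite -sum_binomial // big_distrl /=.
elim: n => [|n IH]; first by rewrite big_ord0; exact: len_refl.
rewrite big_ord_recr /= addnC; apply: len_cat IH => //.
have := @len_monomials _ (rev s) setT n r regs (is_idealT R).
by rewrite gen_rev size_rev mulTI //; apply.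
Qed.

(** If t spans m modulo m^2, its degree-j monomials span m^j modulo m^(j+1), so their number bounds
    the length of that layer. *)
Lemma len_exp_gens m t n : maximal_ideal m -> (0 < size t)%N ->
    gen t `<=` m -> m `<=` addI (gen t) (ideal_exp m 2) ->
  exists l, len (ideal_exp m n) setT l /\ (l <= 'C((n + size t).-1, size t))%N.
Proof.
move=> mm t0 tm mt; have im : is_ideal m by case: mm.
rewrite -sum_binomial //; elim: n => [|n [l [hl lC]]].
  by exists 0%N; rewrite big_ord0; split=> //; exact: len_refl.
have mE : addI (ideal_exp m n.+1) (gen (monomials t n)) = ideal_exp m n.
  rewrite gen_monomials; apply/seteqP; split.
    by apply: addI_min => //; [exact: exp_sub | exact: expSub].
  elim: n {l hl lC} => [|n IH]; first by move=> x _; apply: sub_addIr.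
  rewrite expS; apply: mul_min; first exact: is_ideal_addI.
  move=> x y /[dup] mx /mt[x1 tx1 [x2 m2x2 ex]] my; have [y1 my1 [y2 ty2 ey]] := IH _ my.
  exists (x * y1 + x2 * y2); last first.
    by exists (x1 * y2); [rewrite expS; exact: mem_mul | rewrite -ey -ex; ring].
  apply: (idealD (ideal_exp_ideal _ _)); first by rewrite expS; exact: mem_mul.
  rewrite -(addn2 n) addnC expD; apply: mem_mul => //.
  exact: expSub ty2.
have [|p [hp ps]] := @len_gens _ m (ideal_exp m n.+1) (monomials t n) mm (ideal_exp_ideal _ _).
  move=> k y mk /mem_gen; rewrite gen_monomials => ty.
  by rewrite expS; apply: mem_mul => //; exact: expSub ty.
exists (p + l)%N; split; first by rewrite mE in hp; exact: len_cat hp hl.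
by rewrite big_ord_recr /= addnC leq_add // -size_monomials.
Qed.

Lemma len_primary J m c : noetherian R -> maximal_ideal m -> is_ideal J -> ~ J 1 ->
  ideal_exp m c `<=` J -> exists r, (0 < r)%N /\ len J setT r.
Proof.
move=> noeR mm iJ J1 mJ.
have [l] := @len_exp_maximal _ m setT c noeR mm (is_idealT R).
rewrite mulIC mulTI // => hl; have [r [hr _]] := len_sub (is_idealT R) mJ (@subsetT _ _) hl.
exists r; split=> //; apply: (max_chain_length_le hr).
apply: (has_chainS (D := J)) => //; last exact: has_chain0.
by split=> // /(_ 1 I).
Qed.

(* The case needed of Krull's height theorem: comparing the growth of the
   colengths of J^n and of m^(cn), which is contained in J^n. *)
Lemma embedding_dim m s t : noetherian R -> local_ring m -> krull_dim R (size s) ->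
    regular_sequence s -> (0 < size t)%N -> (size t < size s)%N -> gen t `<=` m ->
  ~ m `<=` addI (gen t) (ideal_exp m 2).
Proof.
move=> noeR lm dimR regs t0 ts tm mt; have mm := lm.1.
have [c0 mJ0] := regular_seq_exp_sub noeR lm dimR regs.
have mJ : ideal_exp m c0.+1 `<=` gen s by apply: subset_trans mJ0; exact: exp_sub.
have [r [r0 hr]] := len_primary noeR mm (is_ideal_gen s) regs.1 mJ.
(* With d = [size s], e = [size t] and c = c0 + 1, which is positive, n^d <= d! l(R/J^n) <= d!
   l(R/m^(cn)) <= d! C(cn+e-1, e). The last binomial is a polynomial of degree at most e < d in
   n. *)
have := @poly_growth (binomial_poly (size t)) (size s) c0.+1 (size s)`! 0 isT.
apply/not_implyP; split; last first.
  by apply/negP; rewrite -leqNgt (leq_trans (size_binomial_poly _)).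
move=> n _; rewrite binomial_polyE -natrM ler_nat.
apply: leq_trans (leq_exp_rising n (size s)) _; rewrite mulnC leq_mul2l; apply/orP; right.
have s0 := ltn_trans t0 ts.
have [l [hl lC]] := len_exp_gens (c0.+1 * n) mm t0 tm mt.
apply: leq_trans lC; apply: leq_trans (leq_pmulr _ r0) _.
apply: (max_chain_length_le hl).
have [c [Cc cS]] := (len_exp_regular n s0 regs hr).1.
exists c; split=> // i /Cc[iD sD _]; split=> //; apply: subset_trans sD.
by rewrite exp_exp; exact: expSub.
Qed.

Lemma regular_dot s a : regular_sequence s -> size a = size s ->
  ideal_exp (gen s) 2 (dot a s) -> forall k, k \in a -> gen s k.
Proof.
move=> /rev_regularP/(@regular_monomials_free _ _ 1).
by rewrite /monomials_free monomials1 revK gen_rev; exact.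
Qed.

Lemma gen_split s1 z s2 : gen (s1 ++ z :: s2) = gen (z :: s1 ++ s2).
Proof. by apply: eq_gen; apply: perm_mem; rewrite perm_catC /= perm_cons perm_catC. Qed.

(** As k is a unit, xw can replace z among the generators of J. Multiplication by w maps m into J,
    and every y in m can be corrected by a multiple of x to some u with uw in the ideal A of the
    remaining generators; such a u lies in J. *)
Lemma colon_gens m s1 z s2 x w k v : local_ring m ->
    regular_sequence (s1 ++ z :: s2) ->
    (forall y, m y -> gen (s1 ++ z :: s2) (y * w)) ->
    gen (s1 ++ s2) v -> x * w = k * z + v -> ~ m k ->
  m `<=` gen (x :: s1 ++ s2).
Proof.
set s := s1 ++ z :: s2; set A := gen (s1 ++ s2).
move=> lm regs mw Av xw nmk y my; have [c ck] := local_unit lm nmk.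
have iA : is_ideal A := is_ideal_gen _.
have := mw y my; rewrite gen_split => /gen_cons[b Ab].
pose u := y - b * c * x.
have Auw : A (u * w).
  rewrite (_ : _ * _ = (y * w - b * z) - (b * c) * v).
    by apply: (idealB iA) => //; exact: (idealMl iA).
  have -> : b * z = b * (c * k) * z by rewrite ck mulr1.
  have -> : u * w = y * w - b * c * (x * w) by rewrite /u; ring.
  by rewrite xw; ring.
(* Computing u(xw) in two ways gives (uk)z + (uv - x(uw)) = 0, where the second term lies in A. This
   is a linear relation among the elements of s, so quasi-regularity puts uk, and hence u, in J. *)
have su : gen s u.
  rewrite -[u]mulr1 -ck mulrC -mulrA (mulrC k); apply: (idealMl (is_ideal_gen _)).
  have : A (u * v - x * (u * w)) by apply: (idealB iA) => //; exact: (idealMl iA).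
  move=> /genP[e]; rewrite size_cat => se ee.
  have [e1 [e2 [eE se1 se2]]] : exists e1 e2,
      [/\ e = e1 ++ e2, size e1 = size s1 & size e2 = size s2].
    exists (take (size s1) e), (drop (size s1) e); rewrite cat_take_drop.
    by rewrite size_takel ?size_drop se ?addKn ?leq_addr.
  apply: (@regular_dot s (e1 ++ u * k :: e2)) => //.
  - by rewrite !size_cat /= se1 se2.
  - rewrite dot_cat // dot_cons addrCA -dot_cat // -eE -ee.
    rewrite (_ : u * k * z + _ = u * (k * z + v) - x * (u * w)); last by ring.
    rewrite -xw mulrCA subrr; exact: (ideal0 (ideal_exp_ideal _ _)).
  - by rewrite mem_cat inE eqxx orbT.
have sx : gen s `<=` gen (x :: s1 ++ s2).
  rewrite gen_split; apply: gen_min => // y'; rewrite inE => /orP[/eqP ->|].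
    apply/gen_cons; exists (c * w).
    rewrite (_ : _ - _ = - (c * v)); first by apply: (idealN iA); exact: (idealMl iA).
    have ez : z = c * (x * w - v) by rewrite xw addrK mulrA ck mul1r.
    by rewrite ez; ring.
  by move=> y's; apply: gen_consr; exact: mem_gen.
rewrite -(subrK (b * c * x) y); apply: (idealD (is_ideal_gen _)); first exact: sx.
by apply: (idealMl (is_ideal_gen _)); apply: mem_gen; rewrite inE eqxx.
Qed.

End Colengths.

(** * The link I = J : m *)

Section Links.
Variable R : comNzRingType.
Implicit Types (I J m : set R) (a s : seq R) (k w x y : R) (i n : nat).

Lemma is_ideal_colon J m : is_ideal J -> is_ideal (colon J m).
Proof.
move=> iJ; split=> [y _|x x' Jx Jx' y my|r x Jx y my].
- by rewrite mul0r; exact: ideal0.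
- by rewrite mulrDl; apply: idealD => //; [exact: Jx|exact: Jx'].
- by rewrite -mulrA; apply: idealMl => //; exact: Jx.
Qed.

Lemma sub_colon J m : is_ideal J -> J `<=` colon J m.
Proof. by move=> iJ x Jx y _; exact: idealMr. Qed.

(** If a product xw is not in mJ, some coefficient in an expression of xw by the generators is a
    unit, and [colon_gens] exchanges that generator for x. *)
Lemma maximal_mul_colon m s : local_ring m -> regular_sequence s ->
    (forall x i, m x -> (i < size s)%N ->
      ~ m `<=` gen (x :: take i s ++ drop i.+1 s)) ->
  ideal_mul m (colon (gen s) m) = ideal_mul m (gen s).
Proof.
move=> lm regs nodd; have mm := lm.1; have im : is_ideal m by case: mm.
apply/seteqP; split; last by apply: mulSr; apply: sub_colon.
apply: mul_min => // x w mx sw; apply: contrapT => nxw.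
have [a sa ea] : exists2 a, size a = size s & x * w = dot a s.
  by apply: genP; rewrite mulrC; exact: sw.
have [i il nmi] : exists2 i, (i < size s)%N & ~ m a`_i.
  apply: contrapT => nex; apply: nxw; rewrite ea.
  apply: (ideal_dot (is_ideal_mul _ _)) => // k y ka ys; apply: mem_mul; last exact: mem_gen.
  apply: contrapT => nmk; apply: nex; exists (index k a).
    by rewrite -sa index_mem.
  by rewrite nth_index.
apply: (nodd x i) => //.
have es : s = take i s ++ s`_i :: drop i.+1 s by rewrite -drop_nth // cat_take_drop.
have ea' : a = take i a ++ a`_i :: drop i.+1 a by rewrite -drop_nth ?sa // cat_take_drop.
have st : size (take i a) = size (take i s) by rewrite !size_takel ?sa // ltnW.
pose v := dot (take i a ++ drop i.+1 a) (take i s ++ drop i.+1 s).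
apply: (@colon_gens _ m _ s`_i _ x w a`_i v) => //; rewrite -?es //.
- by move=> y my; rewrite mulrC; exact: sw.
- by apply: gen_dot; rewrite !size_cat st !size_drop sa.
- by rewrite ea {1}es {1}ea' dot_cat // dot_cons addrCA -dot_cat.
Qed.

Lemma size_take_drop s i : (i < size s)%N ->
  size (take i s ++ drop i.+1 s) = (size s).-1.
Proof. by move=> il; rewrite size_cat size_takel ?size_drop 1?ltnW //; lia. Qed.

Lemma take_drop_sub m x s i : is_ideal m -> m x -> gen s `<=` m ->
  gen (x :: take i s ++ drop i.+1 s) `<=` m.
Proof.
move=> im mx sm; apply: gen_min => // y; rewrite inE mem_cat => /or3P[/eqP -> //|ys|ys].
  by apply: sm; apply: mem_gen; exact: (mem_take ys).
by apply: sm; apply: mem_gen; exact: (mem_drop ys).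
Qed.

Lemma link_nonregular m s x i : noetherian R -> local_ring m ->
    krull_dim R (size s) -> regular_sequence s -> ~ regular_local_ring m ->
    m x -> (i < size s)%N ->
  ~ m `<=` gen (x :: take i s ++ drop i.+1 s).
Proof.
move=> noeR lm dimR regs nreg mx il mg; have im : is_ideal m by case: lm.1.
have sm := local_sub lm (is_ideal_gen s) regs.1.
apply: nreg; split=> //; exists (size s) => //.
have st : size (x :: take i s ++ drop i.+1 s) == size s.
  by rewrite /= size_take_drop // prednK // (leq_trans _ il).
exists (Tuple st); apply/seteqP; split=> //.
exact: take_drop_sub.
Qed.

(** At least one of the two elements in m^2 survives the removal of the i-th generator. It is
    redundant modulo m^2, so d - 1 elements would span m modulo m^2, against [embedding_dim]. *)
Lemma link_regular m s x i j1 j2 : noetherian R -> local_ring m ->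
    krull_dim R (size s) -> regular_sequence s ->
    (j1 < size s)%N -> (j2 < size s)%N -> j1 <> j2 ->
    ideal_exp m 2 s`_j1 -> ideal_exp m 2 s`_j2 ->
    m x -> (i < size s)%N ->
  ~ m `<=` gen (x :: take i s ++ drop i.+1 s).
Proof.
move=> noeR lm dimR regs l1 l2 j12 m1 m2 mx il mg; have im : is_ideal m by case: lm.1.
have sm := local_sub lm (is_ideal_gen s) regs.1.
have [j [jl ji mj]] : exists j, [/\ (j < size s)%N, j <> i & ideal_exp m 2 s`_j].
  by have [e|] := pselect (j1 = i); [exists j2; split=> // e'; apply: j12; rewrite e|exists j1].
set t := x :: _ in mg.
have tj : s`_j \in t.
  rewrite inE mem_cat; apply/or3P.
  have [ij|ji'|ij] := ltngtP i j; last by case: ji.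
    apply: Or33; rewrite (_ : s`_j = (drop i.+1 s)`_(j - i.+1)); last by rewrite nth_drop subnKC.
    by rewrite mem_nth // size_drop ltn_sub2r // (leq_trans _ jl).
  apply: Or32; rewrite (_ : s`_j = (take i s)`_j); last by rewrite nth_take.
  by rewrite mem_nth // size_takel // ltnW.
have st : size t = size s by rewrite /= size_take_drop // prednK // (leq_trans _ il).
have tm : gen t `<=` m by exact: take_drop_sub.
have s1 : (1 < size s)%N by lia.
have sr : size (rem s`_j t) = (size s).-1 by rewrite size_rem // st.
apply: (@embedding_dim _ m s (rem s`_j t)) => //; rewrite ?sr; try lia.
  by apply: subset_trans tm; apply: gen_sub => y; exact: mem_rem.
apply: subset_trans mg _; apply: gen_min; first exact: is_ideal_addI.
move=> y; rewrite (perm_mem (perm_to_rem tj)) inE => /orP[/eqP ->|yt].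
  exact: sub_addIr.
by apply: sub_addIl => //; exact: mem_gen.
Qed.

Section Colon.
Variables (m J I : set R) (s : seq R).
Hypotheses (lm : local_ring m) (regs : regular_sequence s) (s0 : (0 < size s)%N).
Hypotheses (eJ : J = gen s) (eI : I = colon J m).
Hypothesis mIJ : ideal_mul m I = ideal_mul m J.

Let im : is_ideal m. Proof. by case: lm.1. Qed.
Let iJ : is_ideal J. Proof. by rewrite eJ. Qed.
Let iI : is_ideal I. Proof. by rewrite eI; exact: is_ideal_colon. Qed.
Let JI : J `<=` I. Proof. by rewrite eI; exact: sub_colon. Qed.
Let Jm : J `<=` m. Proof. by rewrite eJ; apply: local_sub => //; exact: regs.1. Qed.

(** If I were the unit ideal, then m = mJ and so J would be contained in J^2. The sum of the
    generators would lie in J^2, and quasi-regularity would put its coefficient 1 in J. *)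
Lemma colon_sub_maximal : I `<=` m.
Proof.
apply: local_sub => // I1.
have mJ : m `<=` ideal_mul J m.
  by rewrite mulIC -{1}(mulTI im) mulIC -(ideal1 iI I1) mIJ.
have JJ : J `<=` ideal_exp J 2.
  rewrite expS exp1 //; apply: (subset_trans Jm); apply: (subset_trans mJ).
  by apply: mulSr; apply: (subset_trans mJ); exact: mul_subl.
apply: regs.1; apply: (@regular_dot _ s (nseq (size s) 1)) => //.
- by rewrite size_nseq.
- rewrite -eJ; apply: JJ; rewrite eJ; apply: gen_dot; exact: size_nseq.
- by rewrite mem_nseq s0 eqxx.
Qed.

(** A product w w' lies in J; let b_k be its coefficients on the generators. For x in m, x w w' lies
    in J m I = J m J, hence in J^2, so every x b_k is in J. Thus each b_k lies in J : m = I. *)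
Lemma colon_mul : ideal_mul I I `<=` ideal_mul I J.
Proof.
apply: mul_min => // w w' Iw Iw'.
have mw x v : m x -> I v -> ideal_mul m J (x * v).
  by move=> mx Iv; rewrite -mIJ; exact: mem_mul.
have : gen s (w * w').
  by rewrite -eJ; apply: (mul_subr iJ (mw _ _ (colon_sub_maximal Iw) Iw')).
move=> /genP[b sb eb]; rewrite eb.
apply: (ideal_dot (is_ideal_mul _ _)) => // k y kb ys.
apply: mem_mul; last by rewrite eJ; exact: mem_gen.
rewrite eI => x mx; rewrite eJ.
apply: (@regular_dot _ s [seq x * k | k <- b]) => //; first by rewrite size_map.
  rewrite dot_mull -eb mulrA -eJ.
  suff : ideal_mul (ideal_mul J m) I (x * w * w').
    have eJ2 : ideal_mul J J = ideal_exp J 2 by rewrite expS exp1.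
    by rewrite -mulIA mIJ mulICA eJ2 => /(mul_subr (ideal_exp_ideal _ _)).
  by apply: mem_mul => //; rewrite mulIC; exact: mw.
by rewrite [k * x]mulrC; exact: map_f.
Qed.

Lemma colon_exp n : ideal_exp I n.+1 = ideal_mul I (ideal_exp J n).
Proof.
elim: n => [//|n IH]; rewrite expS IH; apply/seteqP; split.
  by rewrite mulIA expS [X in _ `<=` X]mulIA; apply: mulSl; exact: colon_mul.
by apply: mulSr; rewrite expS; exact: mulSl.
Qed.

(** A single factor m turns each factor I into J in succession, since mI = mJ returns the factor m
    after every exchange. *)
Lemma maximal_exp_colon (a : nat) i :
  ideal_mul (ideal_exp m a.+1) (ideal_exp I i) =
  ideal_mul (ideal_exp m a.+1) (ideal_exp J i).
Proof.
elim: i => // i IH.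
have mE K L : ideal_mul (ideal_exp m a.+1) (ideal_mul K L) =
    ideal_mul (ideal_mul m K) (ideal_mul (ideal_exp m a) L).
  by rewrite expS -!mulIA; congr ideal_mul; rewrite mulICA.
by rewrite !(expS _ i) mE mIJ -mE mulICA IH mulICA.
Qed.

End Colon.
End Links.

(** * Rees algebras *)

Section Rees.
Variables (R : comNzRingType) (m I : set R).
Hypotheses (im : is_ideal m) (iI : is_ideal I).
Implicit Types (p q : rees I) (c x y : R) (n i j k : nat).

Lemma rees_coef p i : ideal_exp I i (val p)`_i.
Proof. by have /asboolP := valP p. Qed.

Lemma rees_monomial c i : ideal_exp I i c -> exists q, val q = c *: 'X^i.
Proof.
move=> Ic; have h : rees_pred I (c *: 'X^i).
  apply/asboolP => j; rewrite coefZ coefXn; case: eqP => [->|_].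
    by rewrite mulr1.
  by rewrite mulr0; exact: (ideal0 (ideal_exp_ideal _ _)).
by exists (Sub (c *: 'X^i) h); rewrite SubK.
Qed.

Lemma rees_val0 : val (0 : rees I) = 0. Proof. exact: raddf0. Qed.
Lemma rees_valD p q : val (p + q) = val p + val q. Proof. exact: raddfD. Qed.
Lemma rees_valB p q : val (p - q) = val p - val q. Proof. exact: raddfB. Qed.
Lemma rees_valM p q : val (p * q) = val p * val q. Proof. exact: rmorphM. Qed.

(* The component of degree i of the n-th power of the ideal (m, It). *)
Definition mxpow n i : set R := ideal_mul (ideal_exp m (n - i)) (ideal_exp I i).

Lemma is_ideal_mxpow n i : is_ideal (mxpow n i).
Proof. exact: is_ideal_mul. Qed.
Hint Resolve is_ideal_mxpow : core.

Lemma mxpow_sub n i : mxpow n i `<=` ideal_exp I i.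
Proof. exact: mul_subr. Qed.

Lemma mxpow_ge n i : (n <= i)%N -> mxpow n i = ideal_exp I i.
Proof. by rewrite /mxpow -subn_eq0 => /eqP ->; rewrite mulTI. Qed.

(** With truncated subtraction (a - i) + (b - j) can exceed (a + b) - (i + j); the larger power of m
    is contained in the smaller. *)
Lemma mxpowM a b i j x y : mxpow a i x -> mxpow b j y -> mxpow (a + b) (i + j) (x * y).
Proof.
move=> ax by_; suff: ideal_mul (mxpow a i) (mxpow b j) `<=` mxpow (a + b) (i + j).
  by apply; exact: mem_mul.
rewrite /mxpow -mulIA (mulICA (ideal_exp I i)) mulIA -!expD.
by apply: mulSl; apply: exp_sub; lia.
Qed.

(** The conditions defining the n-th power are imposed in the degrees below i only. The filtration
    descends from the whole ring at i = 0 to that power at i = n; from degree n on there is no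
    further condition. *)
Definition rees_filtration n i : set (rees I) :=
  [set p : rees I | forall j, (j < i)%N -> mxpow n j (val p)`_j].

Lemma rees_filtrationP n p :
  rees_filtration n n p <-> forall i, mxpow n i (val p)`_i.
Proof.
split=> [h i|h j _]; last exact: h.
by case: (ltnP i n) => [/h //|ni]; rewrite mxpow_ge //; exact: rees_coef.
Qed.

Lemma is_ideal_filtration n i : is_ideal (rees_filtration n i).
Proof.
split=> [j _|p q hp hq j ji|q p hp j ji].
- by rewrite rees_val0 coef0; exact: ideal0.
- by rewrite rees_valD coefD; apply: (idealD (is_ideal_mxpow _ _)); [exact: hp|exact: hq].
- rewrite rees_valM coefM; elim/big_ind: _ => [|x y hx hy|k _].
  + exact: (ideal0 (is_ideal_mxpow _ _)).
  + exact: (idealD (is_ideal_mxpow _ _)).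
  + rewrite -[n]add0n -[X in mxpow _ X](subnKC (leq_ord k)); apply: mxpowM.
      by rewrite mxpow_ge //; exact: rees_coef.
    by apply: hp; apply: leq_ltn_trans ji; exact: leq_subr.
Qed.

Lemma rees_exp_sub n : ideal_exp (rees_max m I) n `<=` rees_filtration n n.
Proof.
elim: n => [|n IH]; first by move=> p _ j.
have max_sub p : rees_max m I p -> rees_filtration 1 1 p.
  apply: ideal_gen_min p; first exact: is_ideal_filtration.
  move=> p [[c mc e]|[c Ic e]]; apply/rees_filtrationP => i.
    rewrite e coefC; case: i => [|i] /=; last exact: ideal0.
    by rewrite /mxpow subn0 exp1 // mulIC mulTI.
  rewrite e coefZ coefX; case: eqP => [->|_].
    by rewrite mulr1 mxpow_ge // exp1.
  by rewrite mulr0; exact: (ideal0 (is_ideal_mxpow _ _)).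
apply: mul_min => [|p q /max_sub/rees_filtrationP hp /IH/rees_filtrationP hq].
  exact: is_ideal_filtration.
apply/rees_filtrationP => i; rewrite rees_valM coefM; elim/big_ind: _ => [|x y hx hy|k _].
- exact: (ideal0 (is_ideal_mxpow _ _)).
- exact: (idealD (is_ideal_mxpow _ _)).
- by rewrite -[n.+1]add1n -[X in mxpow _ X](subnKC (leq_ord k)); exact: mxpowM.
Qed.

(** The coefficients c for which the homogeneous element c t^i lies in the n-th power. An element is
    then recovered as the sum of its homogeneous components. *)
Let Mn n i : set R :=
  [set c | exists2 q, ideal_exp (rees_max m I) n q & val q = c *: 'X^i].

Let is_ideal_Mn n i : is_ideal (Mn n i).
Proof.
split=> [|c c' [q Mq e] [q' Mq' e']|r c [q Mq e]].
- by exists 0; [exact: (ideal0 (ideal_exp_ideal _ _)) | rewrite rees_val0 scale0r].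
- exists (q + q'); first exact: (idealD (ideal_exp_ideal _ _)).
  by rewrite rees_valD e e' scalerDl.
- have [u eu] : exists u : rees I, val u = r *: 'X^0 by apply: rees_monomial.
  exists (u * q); first exact: (idealMl (ideal_exp_ideal _ _)).
  by rewrite rees_valM eu e expr0 alg_polyC mul_polyC scalerA.
Qed.

Let MnM n n' i i' c c' : Mn n i c -> Mn n' i' c' -> Mn (n + n') (i + i') (c * c').
Proof.
move=> [q Mq e] [q' Mq' e']; exists (q * q'); first exact: ideal_expD.
by rewrite rees_valM e e' -scalerAl -scalerAr scalerA -exprD.
Qed.

Let Mn_max n c : ideal_exp m n c -> Mn n 0 c.
Proof.
elim: n c => [|n IH] c mc.
  by have [//|q e] := @rees_monomial c 0; exists q.
rewrite expS in mc; apply: (mul_min (is_ideal_Mn _ _)) mc => x y mx /IH hy.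
rewrite -(add1n n); apply: (@MnM 1 n 0 0) hy.
have [//|q e] := @rees_monomial x 0; exists q => //.
rewrite exp1; last exact: ideal_gen_ideal.
apply: sub_ideal_gen; left; exists x => //.
by rewrite e expr0 alg_polyC.
Qed.

Let Mn_exp i c : ideal_exp I i c -> Mn i i c.
Proof.
elim: i c => [|i IH] c Ic; first exact: Mn_max.
rewrite expS in Ic; apply: (mul_min (is_ideal_Mn _ _)) Ic => x y Ix /IH hy.
rewrite -(add1n i); apply: MnM hy.
have [|q e] := @rees_monomial x 1; first by rewrite exp1.
exists q => //; rewrite exp1; last exact: ideal_gen_ideal.
by apply: sub_ideal_gen; right; exists x => //; rewrite e expr1.
Qed.

Lemma rees_exp n : ideal_exp (rees_max m I) n = rees_filtration n n.
Proof.
apply/seteqP; split=> [|p /rees_filtrationP hp]; first exact: rees_exp_sub.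
have hM i : Mn n i (val p)`_i.
  have [ni|iltn] := leqP n i.
    have [q Mq e] := Mn_exp (rees_coef p i); exists q => //; exact: exp_sub Mq.
  apply: (mul_min (is_ideal_Mn _ _)) (hp i) => x y /Mn_max hx /Mn_exp hy.
  by rewrite -(subnK (ltnW iltn)) -[X in Mn _ X]add0n; exact: MnM.
suff [q Mq e] : exists2 q, ideal_exp (rees_max m I) n q &
    val q = \sum_(i < size (val p)) (val p)`_i *: 'X^i.
  by rewrite (_ : p = q) //; apply: val_inj; rewrite e -poly_def coefK.
elim/big_ind: _ => [|u v [q Mq <-] [q' Mq' <-]|i _]; last exact: hM.
  by exists 0; [exact: (ideal0 (ideal_exp_ideal _ _))|rewrite rees_val0].
by exists (q + q'); [exact: (idealD (ideal_exp_ideal _ _))|rewrite rees_valD].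
Qed.

(** Taking the i-th coefficient identifies the quotient with I^i/[mxpow n i]. Every R-submodule of
    the target comes from an ideal of the Rees algebra, because multiplication by elements of
    positive degree is zero on this quotient. *)
Lemma len_rees_filtration n i l : len (mxpow n i) (ideal_exp I i) l ->
  len (rees_filtration n i.+1) (rees_filtration n i) l.
Proof.
move=> [hl nhl].
pose f (B : set (rees I)) : set R := [set c | exists2 p, B p & (val p)`_i = c].
pose g (C : set R) : set (rees I) :=
  [set p | rees_filtration n i p /\ C (val p)`_i].
have fil_mono c : ideal_exp I i c ->
    exists2 q, rees_filtration n i q & val q = c *: 'X^i.
  move=> Ic; have [q e] := rees_monomial Ic; exists q => // j ji.
  rewrite e coefZ coefXn ltn_eqF // mulr0; exact: (ideal0 (is_ideal_mxpow _ _)).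
have filS p : rees_filtration n i p -> mxpow n i (val p)`_i -> rees_filtration n i.+1 p.
  move=> hp pi j; rewrite ltnS leq_eqVlt => /orP[/eqP -> //|]; exact: hp.
have fg C : C `<=` ideal_exp I i -> f (g C) = C.
  move=> CI; apply/seteqP; split=> [_ [p [_ Cp] <-] //|c Cc].
  have [q hq e] := fil_mono c (CI c Cc).
  have ec : (val q)`_i = c by rewrite e coefZ coefXn eqxx mulr1.
  by exists q => //; split; rewrite ?ec.
have fS B B' : B `<=` B' -> f B `<=` f B' by move=> BB _ [p /BB Bp <-]; exists p.
have gS C C' : C `<=` C' -> g C `<=` g C' by move=> CC p [hp /CC].
split.
  apply: (has_chain_map (f := g) _ _ _ hl) => [C [iC mC CI]|C C' _ _|]; [|exact: gS|].
    split.
    - split=> [|p q [hp Cp] [hq Cq]|r p [hp Cp]].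
      + split; first exact: (ideal0 (is_ideal_filtration _ _)).
        by rewrite rees_val0 coef0; exact: ideal0.
      + split; first exact: (idealD (is_ideal_filtration _ _)).
        by rewrite rees_valD coefD; exact: idealD.
      + split; first exact: (idealMl (is_ideal_filtration _ _)).
        rewrite rees_valM coefM; elim/big_ind: _ => [|x y Cx Cy|[[|k] /= ki] _].
        * exact: ideal0.
        * exact: idealD.
        * by rewrite subn0; exact: idealMl.
        (* A coefficient of r in positive degree meets a coefficient of p in degree below i, where p
           already satisfies the condition; the product falls in [mxpow n i]. *)
        * have {}ki : (k < i)%N := ki.
          apply: mC; rewrite -[n]add0n -[X in mxpow _ X](subnKC ki).
          apply: mxpowM; first by rewrite mxpow_ge //; exact: rees_coef.
          by apply: hp; lia.
    - move=> p hp; split=> [j ji|]; first by apply: hp; exact: leqW.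
      by apply: mC; exact: hp.
    - by move=> p [].
  move=> C C' [_ _ CI] [_ _ C'I] _ /fS; by rewrite !fg.
move=> h; apply: nhl; apply: (has_chain_map (f := f) _ _ _ h) => [B [iB lB Bu]|B B' _ _|].
- split.
  + split=> [|_ _ [p Bp <-] [q Bq <-]|r _ [p Bp <-]].
    * by exists 0; [exact: ideal0|rewrite rees_val0 coef0].
    * by exists (p + q); [exact: idealD|rewrite rees_valD coefD].
    * have [u eu] : exists u : rees I, val u = r *: 'X^0 by apply: rees_monomial.
      exists (u * p); first exact: idealMl.
      by rewrite rees_valM eu expr0 alg_polyC coefCM.
  + move=> c mc; have [q hq e] := fil_mono c (mxpow_sub mc).
    have ec : (val q)`_i = c by rewrite e coefZ coefXn eqxx mulr1.
    by exists q => //; apply: lB; apply: filS; rewrite ?ec.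
  + by move=> _ [p Bp <-]; exact: rees_coef.
- exact: fS.
- move=> B B' [iB lB Bu] [iB' lB' B'u] BB' fBB' p B'p.
  have [q Bq e] : f B (val p)`_i by apply: fBB'; exists p.
  rewrite -(subrK q p); apply: idealD => //; apply: lB; apply: filS.
    apply: (idealB (is_ideal_filtration _ _)); [exact: B'u|exact: Bu].
  by rewrite rees_valB coefB e subrr; exact: (ideal0 (is_ideal_mxpow _ _)).
Qed.

Lemma rees_colength n (l : nat -> nat) :
    (forall i, (i < n)%N -> len (mxpow n i) (ideal_exp I i) (l i)) ->
  colength (ideal_exp (rees_max m I) n) (\sum_(i < n) l i).
Proof.
move=> hl; rewrite colengthE rees_exp.
suff h j : (j <= n)%N -> len (rees_filtration n j) setT (\sum_(i < j) l i) by exact: h.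
elim: j => [_|j IH jn].
  rewrite big_ord0 (_ : rees_filtration n 0 = setT); first exact: len_refl.
  by apply/seteqP; split.
rewrite big_ord_recr /= addnC.
apply: (len_cat (is_ideal_filtration _ _) (is_ideal_filtration _ _)) (IH (ltnW jn)) => //.
by apply: len_rees_filtration; exact: hl.
Qed.

End Rees.

(** * Comparison of multiplicities *)

(** Adding Q sends the Hilbert-Samuel polynomials of M to those of M', and subtracting it goes back.
    Since Q has smaller size, degree and leading coefficient are unchanged. The sets from which
    [xget] selects are therefore equal, even when empty. *)
Lemma multiplicity_shift (B B' : comNzRingType) (M : set B) (M' : set B')
    (Q : {poly rat}) (c q : nat -> nat) :
    (forall n, colength (ideal_exp M n) (c n)) ->
    (forall n, (0 < n)%N -> colength (ideal_exp M' n) (c n + q n)) ->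
    (forall n, (0 < n)%N -> Q.[n%:R] = (q n)%:R) ->
    (forall P, hilbert_samuel_poly M P -> (size Q < size P)%N) ->
  multiplicity M' = multiplicity M.
Proof.
move=> hc hq hQ hsize; congr xget; apply/seteqP; split=> e [P [n0 HP] ->].
  have HPQ : hilbert_samuel_poly M (P - Q).
    (* The successor makes n positive, as [hq] and [hQ] require. *)
    exists n0.+1 => n nn; exists (c n) => //; have n_gt0 := leq_ltn_trans (leq0n _) nn.
    have [l hl el] := HP n (ltnW nn).
    rewrite hornerD hornerN el hQ // (max_chain_length_uniq hl (hq n n_gt0)).
    by rewrite natrD addrK.
  exists (P - Q) => //; have ltQ := hsize _ HPQ.
  by rewrite -[in LHS](subrK Q P) (size_polyDl ltQ) (lead_coefDl ltQ).
have ltQ : (size Q < size P)%N by apply: hsize; exists n0.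
exists (P + Q); last by rewrite (size_polyDl ltQ) (lead_coefDl ltQ).
exists n0.+1 => n nn; have n_gt0 := leq_ltn_trans (leq0n _) nn.
exists (c n + q n)%N; first exact: hq.
have [l hl el] := HP n (ltnW nn).
by rewrite hornerD el hQ // (max_chain_length_uniq hl (hc n)) natrD.
Qed.

Lemma leq_exp_monomials d k t : (0 < d)%N -> (k <= t)%N ->
  (k ^ d.-1 <= d.-1`! * 'C((t + d).-1, t))%N.
Proof.
case: d => // d _ kt; rewrite addnS /= mulnC.
apply: leq_trans (leq_exp_rising k d) _; rewrite leq_mul2r; apply/orP; right.
rewrite -[X in (_ <= X)%N]bin_sub ?leq_addr // addKn.
by apply: leq_bin2l; lia.
Qed.

Section ParameterIdeal.
Variables (R : comNzRingType) (m : set R) (s : seq R).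
Hypotheses (noeR : noetherian R) (lm : local_ring m) (regs : regular_sequence s).
Hypotheses (dimR : krull_dim R (size s)) (s0 : (0 < size s)%N).
Implicit Types (n i k : nat).

Let J := gen s.
Let mm : maximal_ideal m := lm.1.
Let im : is_ideal m. Proof. by case: lm.1. Qed.

Lemma len_exp_gen K r i : is_ideal K -> J `<=` K -> len J K r ->
  len (ideal_exp J i.+1) (ideal_mul K (ideal_exp J i)) ('C((i + size s).-1, i) * r).
Proof.
move=> iK JK hr; have := @len_monomials _ (rev s) K i r (rev_regularP regs) iK.
by rewrite gen_rev size_rev; apply.
Qed.

Lemma len_exp_gen_add i k r : len J setT r ->
  len (ideal_exp J (i + k)) (ideal_exp J i)
      (\sum_(t < k) 'C(((i + t) + size s).-1, i + t) * r).
Proof.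
move=> hr; elim: k => [|k IH]; first by rewrite addn0 big_ord0; exact: len_refl.
rewrite addnS big_ord_recr /= [X in len _ _ X]addnC; apply: len_cat IH => //.
by have := len_exp_gen (i + k) (is_idealT R) (@subsetT _ _) hr; rewrite mulTI.
Qed.

(** For n = (c+2)k and k <= i < 2k the exponent n - i is at least ck, so m^(n-i) J^i is inside
    J^(i+k). The k layers between J^i and J^(i+k) each have length at least k^(d-1)/(d-1)!, and
    there are k such degrees i, which gives the exponent d + 1. *)
Lemma rees_growth (c : nat) (l : nat -> nat -> nat) k : ideal_exp m c `<=` J ->
    (forall n i, len (mxpow m J n i) (ideal_exp J i) (l n i)) ->
  (k ^ (size s).+1 <=
     (size s).-1`! * \sum_(i < c.+2 * k) l (c.+2 * k) i)%N.
Proof.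
move=> mJ hl; set n := (c.+2 * k)%N; set d := size s.
have [r [r0 hr]] := len_primary noeR mm (is_ideal_gen s) regs.1 mJ.
have lower i : (k <= i < k + k)%N -> (k * k ^ d.-1 <= d.-1`! * l n i)%N.
  move=> /andP[ki ik].
  apply: (@leq_trans (d.-1`! * \sum_(t < k) 'C(((i + t) + d).-1, i + t) * r)).
    rewrite big_distrr /= -[X in (X * _ <= _)%N]card_ord -sum_nat_const.
    apply: leq_sum => t _; rewrite mulnA; apply: leq_trans (leq_pmulr _ r0).
    by apply: leq_exp_monomials => //; exact: leq_trans (leq_addr _ _).
  rewrite leq_mul2l; apply/orP; right; apply: (max_chain_length_le (hl n i)).
  have [e [Ce eS]] := (len_exp_gen_add i k hr).1.
  exists e; split=> // j /Ce[ie Je eJ]; split=> //; apply: subset_trans Je.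
  rewrite addnC expD; apply: mulSl.
  apply: (@subset_trans _ (ideal_exp (ideal_exp m c) k)); last exact: expSub.
  by rewrite -exp_exp; apply: exp_sub; rewrite /n !mulSn; lia.
have -> : (k ^ d.+1 = \sum_(k <= i < k + k) k * k ^ d.-1)%N.
  by rewrite sum_nat_const_nat addKn -expnS -expnS prednK.
rewrite -(big_mkord xpredT (l n)) big_distrr /=.
have kn : (k + k <= n)%N by rewrite /n !mulSn; lia.
rewrite (big_cat_nat (leq0n k) (leq_trans (leq_addl _ _) kn)) /=.
rewrite (big_cat_nat (leq_addr k k) kn) /=.
apply: leq_trans (leq_addl _ _); apply: leq_trans (leq_addr _ _).
by rewrite big_nat [X in (_ <= X)%N]big_nat; apply: leq_sum.
Qed.

Lemma multiplicity_link :
    ideal_mul m (colon J m) = ideal_mul m J ->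
  multiplicity (rees_max m (colon J m)) = multiplicity (rees_max m J).
Proof.
move=> mIJ; set I := colon J m; set d := size s.
have iJ : is_ideal J := is_ideal_gen s.
have iI : is_ideal I by exact: is_ideal_colon.
have JI : J `<=` I by exact: sub_colon.
have [l hl] : exists l : nat -> nat -> nat,
    forall n i, len (mxpow m J n i) (ideal_exp J i) (l n i).
  have /choice[l hl] : forall p : nat * nat, exists l,
      len (mxpow m J p.1 p.2) (ideal_exp J p.2) l.
    by move=> p; apply: len_exp_maximal.
  by exists (fun n i => l (n, i)) => n i; exact: (hl (n, i)).
have [c mJ] := regular_seq_exp_sub noeR lm dimR regs.
(* I/J is a quotient of I/mI, which has finite length, because mI = mJ is contained in J. *)
have [r hr] : exists r, len J I r.
  have [p hp] := len_mul_maximal noeR mm iI.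
  have mIsub : ideal_mul m I `<=` J.
    by rewrite mIJ; apply: mul_subr.
  by have [r [hr _]] := len_sub iI mIsub JI hp; exists r.
(* The length of I^i/J^i: it vanishes in degree 0, and in degree j + 1 the quotient is I
   J^j/J^(j+1). *)
pose e i := if i is j.+1 then ('C((j + d).-1, j) * r)%N else 0%N.
have he i : len (ideal_exp J i) (ideal_exp I i) (e i).
  case: i => [|i]; first exact: len_refl.
  rewrite (colon_exp lm regs s0 (erefl _) (erefl _) mIJ).
  exact: len_exp_gen.
have hIl n i : (i < n)%N -> len (mxpow m I n i) (ideal_exp I i) (l n i + e i).
  move=> iln; rewrite /mxpow -(subnSK iln) (maximal_exp_colon mIJ) ?(subnSK iln).
  by apply: (len_cat (B := ideal_exp J i)) => //; exact: hl.
(* The sum of [e i] over i < n is r C((n-1)+d-1, d) when n > 0, because [e] starts with a zero term;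
   hence the shift by one. *)
pose Q : {poly rat} := r%:R *: (binomial_poly d \Po ('X - 1)).
apply: (@multiplicity_shift _ _ _ _ Q (fun n => \sum_(i < n) l n i)%N
                                      (fun n => \sum_(i < n) e i)%N).
- by move=> n; apply: (rees_colength im iJ (l := l n)) => // i _; exact: hl.
- move=> n _; rewrite -big_split /=.
  by apply: (rees_colength im iI (l := fun i => l n i + e i)%N) => i; exact: hIl.
- case=> // n _; rewrite hornerZ horner_comp hornerD hornerX hornerN hornerC.
  rewrite -natr1 addrK binomial_polyE -natrM big_ord_recl /= add0n.
  by rewrite -sum_binomial // big_distrr /=; congr (_%:R); apply: eq_bigr => i _; rewrite mulnC.
move=> P [n0 HP]; apply: (@leq_ltn_trans d.+1).
  apply: leq_trans (size_scale_leq _ _) _.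
  rewrite size_comp_poly2 ?size_XsubC //; exact: size_binomial_poly.
apply: (@poly_growth P _ c.+2 d.-1`! n0) => // n n0n.
have [|p hp ->] := HP (c.+2 * n)%N; first by rewrite mulSn; lia.
rewrite -natrM ler_nat.
have hN : colength (ideal_exp (rees_max m J) (c.+2 * n)) (\sum_(i < c.+2 * n) l (c.+2 * n)%N i).
  by apply: (rees_colength im iJ (l := l _)) => // i _; exact: hl.
by rewrite (max_chain_length_uniq hp hN); exact: rees_growth.
Qed.

End ParameterIdeal.

Theorem theorem4p1 (R : comNzRingType) (m : set R) (d : nat)
    (hGor : gorenstein_local_ring m) (hdim : krull_dim R d) (hd : (0 < d)%N)
    (z : d.-tuple R) (hz : regular_sequence z)
    (J : set R) (hJ : J = ideal_gen [set` z])
    (I : set R) (hI : I = colon J m)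
    (hL : ~ regular_local_ring m \/
          [/\ regular_local_ring m, (2 <= d)%N &
              exists i j : 'I_d,
                [/\ i != j, ideal_exp m 2 (tnth z i) &
                    ideal_exp m 2 (tnth z j)]]) :
  multiplicity (rees_max m I) = multiplicity (rees_max m J).
Proof.
have [noeR lm _] := hGor.
have dimR : krull_dim R (size z) by rewrite size_tuple.
have eJ : J = gen z by rewrite hJ; congr ideal_gen; apply/seteqP; split.
rewrite hI eJ; apply: multiplicity_link => //; first by rewrite size_tuple.
apply: maximal_mul_colon => // x i mx il.
case: hL => [nreg|[_ _ [j1 [j2 [/eqP j12 z1 z2]]]]].
  exact: link_nonregular.
apply: (@link_regular _ m z x i j1 j2) => //; rewrite ?size_tuple //.
- by move=> /val_inj.
- by rewrite -tnth_nth.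
- by rewrite -tnth_nth.
Qed.
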